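(* Let $F$ be a non-archimedean locally compact field with ring of integers $\mathcal O$, maximal ideal $\mathfrak p$ and residue field $k$ of characteristic $p$. Let $n\geq1$, $\tilde G=\mathrm{GL}_n(F)$, $K_1=1+\mathfrak p M_n(\mathcal O)$, and let $I_1$ be the standard pro-$p$ Iwahori subgroup of $\tilde G$. Let $\mathcal C=\mathrm{ind}_{I_1}^{\tilde G}(1)$ be the compact induction over $\overline{\mathbf F}_p$ and $\mathcal H=\mathrm{End}_{\tilde G}(\mathcal C)$. Let $G=\mathrm{GL}_n(k)$, $U\subset G$ the subgroup of upper triangular unipotent matrices, $C$ the representation of $G$ over $\overline{\mathbf F}_p$ induced from the trivial character of $U$, and $H=\mathrm{End}_G(C)$. Then the left $\mathcal H$-module $\mathcal C^{K_1}$ of $K_1$-invariants of $\mathcal C$ is flat if and only if the $H$-module $C$ is flat.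
   Context: $\overline{\mathbf F}_p$ is an algebraic closure of $k$. $I_1$ is the group of matrices in $\mathrm{GL}_n(\mathcal O)$ whose reduction modulo $\mathfrak p$ lies in $U$. $\mathcal C$ is the space of functions $I_1\backslash\tilde G\to\overline{\mathbf F}_p$ with finite support, with $\tilde G$ acting by right translations; it is a left $\mathcal H$-module and $\mathcal C^{K_1}$ is an $\mathcal H$-submodule. $C$ is the space of functions $G\to\overline{\mathbf F}_p$ invariant under left translations by $U$, with $G$ acting by right translations; it is a left $H$-module. *)

(* Defs.v *)
From HB Require Import structures.
From mathcomp Require Import all_boot all_order all_algebra.
From mathcomp Require Import all_classical all_reals all_analysis.

Set Implicit Arguments.
Unset Strict Implicit.
Unset Printing Implicit Defensive.

Import Order.TTheory GRing.Theory Num.Theory.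
Local Open Scope classical_set_scope.
Local Open Scope ring_scope.
Local Open Scope quotient_scope.

(* Right A-modules are left modules over the converse ring A^c, so [a *: x]
   below, for x in N, is the right action x.a *)

Section Tensor.
Variables (A : pzRingType) (N : lmodType A^c) (M : lmodType A).

(* The sequence [:: (x1, y1); ...; (xr, yr)] stands for the element
   x1 (x) y1 + ... + xr (x) yr of N (x)_A M *)
Inductive tens_eq : seq (N * M) -> seq (N * M) -> Prop :=
| tens_refl s : tens_eq s s
| tens_sym s t : tens_eq s t -> tens_eq t s
| tens_trans s t u : tens_eq s t -> tens_eq t u -> tens_eq s u
| tens_cat s t s' t' :
    tens_eq s t -> tens_eq s' t' -> tens_eq (s ++ s') (t ++ t')
| tens_comm s t : tens_eq (s ++ t) (t ++ s)
| tens_zero y : tens_eq [:: (0, y)] [::]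
| tens_addl x x' y : tens_eq [:: (x + x', y)] [:: (x, y); (x', y)]
| tens_addr x y y' : tens_eq [:: (x, y + y')] [:: (x, y); (x, y')]
| tens_bal (a : A) x y : tens_eq [:: ((a : A^c) *: x, y)] [:: (x, a *: y)].

Definition tens_eqb (s t : seq (N * M)) : bool := `[< tens_eq s t >].

Lemma tens_eqb_equiv : equiv_class_of tens_eqb.
Proof.
split=> [s|s t|s t u]; first by apply/asboolP; exact: tens_refl.
- by apply/asboolP/asboolP; exact: tens_sym.
- move=> /asboolP st /asboolP tu; apply/asboolP; exact: tens_trans st tu.
Qed.

Canonical tens_equiv := EquivRelPack tens_eqb_equiv.
Canonical tens_encModRel := defaultEncModRel tens_eqb.

Definition tensor := {eq_quot tens_eqb}.

HB.instance Definition _ : EqQuotient _ tens_eqb tensor := EqQuotient.on tensor.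
HB.instance Definition _ := Choice.on tensor.

Lemma tens_piP s t : \pi_tensor s = \pi_tensor t <-> tens_eq s t.
Proof. by split=> [/eqmodP/asboolP|st]; last by apply/eqmodP/asboolP. Qed.

Lemma tens_reprP s : tens_eq (repr (\pi_tensor s)) s.
Proof. by apply/tens_piP; rewrite reprK. Qed.

Definition tens_opp_seq (s : seq (N * M)) := [seq (- p.1, p.2) | p <- s].

Lemma tens_addNs s : tens_eq (tens_opp_seq s ++ s) [::].
Proof.
elim: s => [|[x y] s ih]; first exact: tens_refl.
have xy : tens_eq [:: (- x, y); (x, y)] [::].
  apply: tens_trans (tens_zero y); rewrite -(addNr x).
  exact/tens_sym/tens_addl.
have -> : tens_opp_seq ((x, y) :: s) ++ (x, y) :: s =
    [:: (- x, y)] ++ ((tens_opp_seq s ++ [:: (x, y)]) ++ s).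
  by rewrite /= -catA.
apply: tens_trans.
  apply: (tens_cat (tens_refl _) (tens_cat (tens_comm _ _) (tens_refl _))).
exact: tens_trans (tens_cat xy ih) (tens_refl _).
Qed.

Lemma tens_eq_opp s t :
  tens_eq s t -> tens_eq (tens_opp_seq s) (tens_opp_seq t).
Proof.
move=> st.
have h1 : tens_eq (tens_opp_seq s) (tens_opp_seq s ++ (tens_opp_seq t ++ t)).
  rewrite -[X in tens_eq X]cats0; apply: tens_cat (tens_refl _) _.
  exact/tens_sym/tens_addNs.
apply: (tens_trans h1).
have h2 : tens_eq (tens_opp_seq s ++ (tens_opp_seq t ++ t))
    ((tens_opp_seq s ++ s) ++ tens_opp_seq t).
  rewrite -catA; apply: tens_cat (tens_refl _) _.
  apply: tens_trans (tens_comm _ _) _; apply: tens_cat (tens_refl _).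
  exact: tens_sym.
exact: tens_trans h2 (tens_cat (tens_addNs s) (tens_refl _)).
Qed.

Definition tens_0 : tensor := \pi_tensor [::].
Definition tens_add (u v : tensor) : tensor := \pi_tensor (repr u ++ repr v).
Definition tens_opp (u : tensor) : tensor := \pi_tensor (tens_opp_seq (repr u)).

Lemma tens_pi_add s t :
  tens_add (\pi_tensor s) (\pi_tensor t) = \pi_tensor (s ++ t).
Proof. by apply/tens_piP/tens_cat; exact: tens_reprP. Qed.

Lemma tens_pi_opp s : tens_opp (\pi_tensor s) = \pi_tensor (tens_opp_seq s).
Proof. by apply/tens_piP/tens_eq_opp; exact: tens_reprP. Qed.

Lemma tens_addA : associative tens_add.
Proof.
elim/quotW=> s; elim/quotW=> t; elim/quotW=> r.
by rewrite (tens_pi_add t r) (tens_pi_add s t) !tens_pi_add catA.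
Qed.

Lemma tens_addC : commutative tens_add.
Proof.
elim/quotW=> s; elim/quotW=> t; rewrite (tens_pi_add s t) (tens_pi_add t s).
by apply/tens_piP/tens_comm.
Qed.

Lemma tens_add0 : left_id tens_0 tens_add.
Proof. by elim/quotW=> s; rewrite (tens_pi_add [::] s). Qed.

Lemma tens_addN : left_inverse tens_0 tens_opp tens_add.
Proof.
elim/quotW=> s; rewrite (tens_pi_opp s) (tens_pi_add _ s).
by apply/tens_piP/tens_addNs.
Qed.

HB.instance Definition _ :=
  GRing.isZmodule.Build tensor tens_addA tens_addC tens_add0 tens_addN.

Definition tens (x : N) (y : M) : tensor := \pi_tensor [:: (x, y)].

Lemma tens_pi_sum s : \pi_tensor s = \sum_(p <- s) tens p.1 p.2.
Proof.
elim: s => [|[x y] s ih]; first by rewrite big_nil.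
by rewrite big_cons -ih -[RHS]/(tens_add _ _) tens_pi_add.
Qed.

Definition balanced (T : zmodType) (b : N -> M -> T) :=
  [/\ forall x x' y, b (x + x') y = b x y + b x' y,
      forall x y y', b x (y + y') = b x y + b x y' &
      forall (a : A) x y, b ((a : A^c) *: x) y = b x (a *: y)].

Lemma tens_balanced : balanced tens.
Proof.
split=> [x x' y|x y y'|a x y]; rewrite /tens.
- by rewrite -[RHS]/(tens_add _ _) tens_pi_add; apply/tens_piP/tens_addl.
- by rewrite -[RHS]/(tens_add _ _) tens_pi_add; apply/tens_piP/tens_addr.
- exact/tens_piP/tens_bal.
Qed.

Definition tens_lift (T : zmodType) (b : N -> M -> T) (u : tensor) : T :=
  \sum_(p <- repr u) b p.1 p.2.

Lemma tens_lift_pi (T : zmodType) (b : N -> M -> T) s : balanced b ->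
  tens_lift b (\pi_tensor s) = \sum_(p <- s) b p.1 p.2.
Proof.
move=> [bDl bDr bZ]; rewrite /tens_lift.
have bE u v : tens_eq u v ->
    \sum_(p <- u) b p.1 p.2 = \sum_(p <- v) b p.1 p.2.
  elim=> {s u v} //=.
  - by move=> s t u _ -> _ ->.
  - by move=> s t s' t' _ e _ e'; rewrite !big_cat /= e e'.
  - by move=> s t; rewrite !big_cat /= addrC.
  - move=> y; rewrite big_seq1 big_nil /=.
    by apply: (addIr (b 0 y)); rewrite -bDl !add0r.
  - by move=> x x' y; rewrite big_seq1 big_cons big_seq1 /= bDl.
  - by move=> x y y'; rewrite big_seq1 big_cons big_seq1 /= bDr.
  - by move=> a x y; rewrite !big_seq1 /= bZ.
exact/bE/tens_reprP.
Qed.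

Lemma tens_liftD (T : zmodType) (b : N -> M -> T) :
  balanced b -> {morph tens_lift b : u v / u + v}.
Proof.
move=> bb; elim/quotW=> s; elim/quotW=> t.
rewrite -[X in tens_lift b X]/(tens_add _ _) tens_pi_add.
by rewrite !tens_lift_pi // big_cat.
Qed.

Lemma tens_universal (T : zmodType) (b : N -> M -> T) : balanced b ->
  exists! g : tensor -> T,
    {morph g : u v / u + v} /\ forall x y, g (tens x y) = b x y.
Proof.
move=> bb; exists (tens_lift b); split.
  by split=> [|x y]; [exact: tens_liftD|rewrite tens_lift_pi // big_seq1].
move=> g [gD gb]; apply/funext; elim/quotW=> s; rewrite tens_lift_pi //.
elim: s => [|[x y] s ih].
  by rewrite big_nil; apply: (addIr (g 0)); rewrite add0r -gD add0r.
by rewrite big_cons ih -gb -gD -[X in g X]/(tens_add _ _) tens_pi_add.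
Qed.

End Tensor.

Definition tens_map (A : pzRingType) (N' N : lmodType A^c) (M : lmodType A)
    (f : {linear N' -> N}) : tensor N' M -> tensor N M :=
  tens_lift (fun x y => tens (f x) y).
Arguments tens_map {A N' N} M f _.

Lemma tens_map_balanced (A : pzRingType) (N' N : lmodType A^c)
    (M : lmodType A) (f : {linear N' -> N}) :
  balanced (fun (x : N') (y : M) => tens (f x) y).
Proof.
have [tDl tDr tZ] := tens_balanced N M.
by split=> [x x' y|x y y'|a x y]; rewrite ?linearD ?linearZ //=.
Qed.

Lemma tens_mapE (A : pzRingType) (N' N : lmodType A^c) (M : lmodType A)
    (f : {linear N' -> N}) (x : N') (y : M) :
  tens_map M f (tens x y) = tens (f x) y.
Proof. by rewrite /tens_map tens_lift_pi ?big_seq1 //; exact: tens_map_balanced. Qed.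

Lemma tens_mapD (A : pzRingType) (N' N : lmodType A^c) (M : lmodType A)
    (f : {linear N' -> N}) : {morph tens_map M f : u v / u + v}.
Proof. exact/tens_liftD/tens_map_balanced. Qed.

Definition flat (A : pzRingType) (M : lmodType A) : Prop :=
  forall (N' N : lmodType A^c) (f : {linear N' -> N}),
    injective f -> injective (tens_map M f).
Arguments flat A M : clear implicits.

HB.mixin Record isRep (K : fieldType) (V : lmodType K) (G : groupType)
    (rho : G -> V -> V) := {
  rep_linear : forall g, linear (rho g);
  rep1 : rho 1%g =1 id;
  repM : forall g h v, rho (g * h)%g v = rho g (rho h v)
}.

#[short(type="repType")]
HB.structure Definition Rep (K : fieldType) (V : lmodType K) (G : groupType) :=
  {rho of isRep K V G rho}.

(* V as a left module over its ring of G-endomorphisms, acting by evaluation *)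
Definition gendmod (K : fieldType) (V : lmodType K) (G : groupType)
  (rho : repType V G) : Type := V.

Section EndRing.
Variables (K : fieldType) (V : lmodType K) (G : groupType) (rho : repType V G).

Definition gend_pred : {pred (V -> V)} :=
  fun f => `[< linear f /\ forall g v, f (rho g v) = rho g (f v) >].

Lemma rep_is_linear g : linear (rho g).
Proof. exact: rep_linear. Qed.

HB.instance Definition _ g := GRing.isLinear.Build K V V _ (rho g)
  (rep_is_linear g).

Lemma gend_zmod_closed : zmod_closed gend_pred.
Proof.
split=> [|f h /asboolP[fL fG] /asboolP[hL hG]]; apply/asboolP; split=> //.
- by move=> a u v; rewrite /= scaler0 addr0.
- by move=> g v; rewrite linear0.
- move=> a u v /=; rewrite /GRing.add /GRing.opp /= fL hL.
  by rewrite scalerBr opprD addrACA.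
- by move=> g v; rewrite /GRing.add /GRing.opp /= fG hG linearB.
Qed.

HB.instance Definition _ := GRing.isZmodClosed.Build (V -> V) gend_pred
  gend_zmod_closed.

Record gend := Gend { gend_fun :> V -> V; _ : gend_fun \in gend_pred }.

HB.instance Definition _ := [isSub for gend_fun].
HB.instance Definition _ := [Choice of gend by <:].
HB.instance Definition _ := [SubChoice_isSubZmodule of gend by <:].

Lemma gend_linear (f : gend) : linear f.
Proof. by case: f => f /= /asboolP[]. Qed.

HB.instance Definition _ (f : gend) := GRing.isLinear.Build K V V _ f
  (gend_linear f).

Lemma gend_rep (f : gend) g v : f (rho g v) = rho g (f v).
Proof. by case: f => f /= /asboolP[]. Qed.

Fact gend_id_subproof : (id : V -> V) \in gend_pred.
Proof. by apply/asboolP; split. Qed.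

Fact gend_comp_subproof (f h : gend) : (f \o h) \in gend_pred.
Proof.
apply/asboolP; split=> [a u v|g v] /=; first by rewrite !linearP.
by rewrite !gend_rep.
Qed.

Definition gend_one := Gend gend_id_subproof.
Definition gend_mul (f h : gend) := Gend (gend_comp_subproof f h).

Lemma gend_mulA : associative gend_mul.
Proof. by move=> f g h; apply/val_inj. Qed.
Lemma gend_mul1 : left_id gend_one gend_mul.
Proof. by move=> f; apply/val_inj. Qed.
Lemma gend_mulr1 : right_id gend_one gend_mul.
Proof. by move=> f; apply/val_inj. Qed.
Lemma gend_mulDl : left_distributive gend_mul +%R.
Proof. by move=> f g h; apply/val_inj. Qed.
Lemma gend_mulDr : right_distributive gend_mul +%R.
Proof. by move=> f g h; apply/val_inj/funext => v /=; rewrite linearD. Qed.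

HB.instance Definition _ := GRing.Zmodule_isPzRing.Build gend
  gend_mulA gend_mul1 gend_mulr1 gend_mulDl gend_mulDr.

Local Notation gendmod := (gendmod rho).

HB.instance Definition _ := GRing.Zmodule.on gendmod.

Definition gend_scale (f : gend) (v : gendmod) : gendmod := f v.

Lemma gend_scaleA f h v :
  gend_scale f (gend_scale h v) = gend_scale (f * h) v.
Proof. by []. Qed.
Lemma gend_scale1 : left_id 1 gend_scale.
Proof. by []. Qed.
Lemma gend_scaleDr : right_distributive gend_scale +%R.
Proof. by move=> f u v; exact: linearD. Qed.
Lemma gend_scaleDl v : {morph gend_scale^~ v : f h / f + h}.
Proof. by []. Qed.

HB.instance Definition _ := GRing.Zmodule_isLmodule.Build gend gendmod
  gend_scaleA gend_scale1 gend_scaleDr gend_scaleDl.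

Section Invariants.
Variable S : set G.

Definition inv_pred : {pred gendmod} :=
  fun v => `[< forall g, S g -> rho g v = v >].

Lemma inv_submod_closed : submod_closed inv_pred.
Proof.
split=> [|f u v /asboolP uS /asboolP vS]; apply/asboolP => g Sg.
  exact: linear0.
by rewrite linearD /= -gend_rep uS // vS.
Qed.

HB.instance Definition _ := GRing.isSubmodClosed.Build gend gendmod inv_pred
  inv_submod_closed.

Record invariants := Invariant { inv_val :> gendmod; _ : inv_val \in inv_pred }.

HB.instance Definition _ := [isSub for inv_val].
HB.instance Definition _ := [Choice of invariants by <:].
HB.instance Definition _ := [SubChoice_isSubLmodule of invariants by <:].

End Invariants.
End EndRing.

Section Induction.
Variables (K : fieldType) (G : groupType) (S : set G).

Definition is_ind (f : G -> K^o) : Prop :=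
  forall s g, S s -> f (s * g)%g = f g.

(* the finitely many orbits S g are the points of the support of f, seen as a
   function on the left quotient S \ G *)
Definition is_cind (f : G -> K^o) : Prop :=
  is_ind f /\
  finite_set [set [set (s * g)%g | s in S] | g in [set g | f g != 0]].

Definition ind_pred : {pred (G -> K^o)} := fun f => `[< is_ind f >].
Definition cind_pred : {pred (G -> K^o)} := fun f => `[< is_cind f >].

Lemma ind_submod_closed : submod_closed ind_pred.
Proof.
split=> [|a f h /asboolP fS /asboolP hS]; apply/asboolP => // s g Ss.
by rewrite /GRing.add /GRing.scale /= fS // hS.
Qed.

Lemma cind_submod_closed : submod_closed cind_pred.
Proof.
split=> [|a f h /asboolP[fS ffin] /asboolP[hS hfin]]; apply/asboolP; split.
- by [].
- rewrite (_ : [set g | _] = set0) ?image_set0 //.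
  by apply/seteqP; split=> // g /=; rewrite eqxx.
- by move=> s g Ss; rewrite /GRing.add /GRing.scale /= fS // hS.
- apply: (@sub_finite_set _ _ (_ `|` _)) (_ : finite_set (_ `|` _)); last first.
    by rewrite finite_setU; split; [exact: ffin|exact: hfin].
  move=> _ [g /= fhg <-]; have [f0|fn0] := eqVneq (f g) 0; last first.
    by left; exists g.
  right; exists g => //=; apply: contra_neq fhg => h0.
  by rewrite /GRing.add /GRing.scale /= f0 h0 scaler0 addr0.
Qed.

HB.instance Definition _ := GRing.isSubmodClosed.Build K (G -> K^o) ind_pred
  ind_submod_closed.
HB.instance Definition _ := GRing.isSubmodClosed.Build K (G -> K^o) cind_pred
  cind_submod_closed.

Record ind := Ind { ind_fun :> G -> K^o; _ : ind_fun \in ind_pred }.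
HB.instance Definition _ := [isSub for ind_fun].
HB.instance Definition _ := [Choice of ind by <:].
HB.instance Definition _ := [SubChoice_isSubLmodule of ind by <:].

Record cind := CInd { cind_fun :> G -> K^o; _ : cind_fun \in cind_pred }.
HB.instance Definition _ := [isSub for cind_fun].
HB.instance Definition _ := [Choice of cind by <:].
HB.instance Definition _ := [SubChoice_isSubLmodule of cind by <:].

Definition rtrans (x : G) (f : G -> K^o) : G -> K^o := fun g => f (g * x)%g.

Fact ind_rtrans_subproof x (f : ind) : rtrans x f \in ind_pred.
Proof.
case: f => f /= /asboolP fS; apply/asboolP => s g Ss.
by rewrite /rtrans -mulgA; exact: fS.
Qed.

Fact cind_rtrans_subproof x (f : cind) : rtrans x f \in cind_pred.
Proof.
case: f => f /= /asboolP[fS ffin]; apply/asboolP; split.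
  by move=> s g Ss; rewrite /rtrans -mulgA; exact: fS.
pose t (A : set G) := [set (g * x^-1)%g | g in A].
apply: (sub_finite_set _ (finite_image t ffin)) => _ [g /= fg <-].
exists [set (s * (g * x))%g | s in S]; first by exists (g * x)%g.
apply/seteqP; split=> [_ [_ [s Ss <-] <-]|_ [s Ss <-]].
  by exists s => //; rewrite !mulgA mulgK.
exists (s * (g * x))%g; first by exists s.
by rewrite !mulgA mulgK.
Qed.

Definition ind_rep x f := Ind (ind_rtrans_subproof x f).
Definition cind_rep x f := CInd (cind_rtrans_subproof x f).

Fact ind_rep_linear x : linear (ind_rep x).
Proof. by move=> a f h; apply/val_inj. Qed.
Fact ind_rep1 : ind_rep 1%g =1 id.
Proof.
by move=> f; apply/val_inj/funext => g; rewrite /= /rtrans mulg1.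
Qed.
Fact ind_repM x y f : ind_rep (x * y)%g f = ind_rep x (ind_rep y f).
Proof. by apply/val_inj/funext => g; rewrite /= /rtrans mulgA. Qed.

HB.instance Definition _ := isRep.Build K ind G ind_rep
  ind_rep_linear ind_rep1 ind_repM.

Fact cind_rep_linear x : linear (cind_rep x).
Proof. by move=> a f h; apply/val_inj. Qed.
Fact cind_rep1 : cind_rep 1%g =1 id.
Proof.
by move=> f; apply/val_inj/funext => g; rewrite /= /rtrans mulg1.
Qed.
Fact cind_repM x y f : cind_rep (x * y)%g f = cind_rep x (cind_rep y f).
Proof. by apply/val_inj/funext => g; rewrite /= /rtrans mulgA. Qed.

HB.instance Definition _ := isRep.Build K cind G cind_rep
  cind_rep_linear cind_rep1 cind_repM.

End Induction.

Arguments ind_rep K {G} S _ _.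
Arguments cind_rep K {G} S _ _.

Section GL.
Variables (n : nat) (R : comUnitRingType).

Record GL := MkGL { GL_mx :> 'M[R]_n; _ : GL_mx \in unitmx }.

HB.instance Definition _ := [isSub for GL_mx].
HB.instance Definition _ := [Choice of GL by <:].

Lemma GL_unit (g : GL) : (g : 'M[R]_n) \in unitmx.
Proof. exact: valP. Qed.

Fact GL_one_subproof : (1%:M : 'M[R]_n) \in unitmx.
Proof. exact: unitmx1. Qed.
Fact GL_inv_subproof (g : GL) : invmx g \in unitmx.
Proof. by rewrite unitmx_inv GL_unit. Qed.
Fact GL_mul_subproof (g h : GL) : (g *m h) \in unitmx.
Proof. by rewrite unitmx_mul !GL_unit. Qed.

Definition GL_one := MkGL GL_one_subproof.
Definition GL_inv (g : GL) := MkGL (GL_inv_subproof g).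
Definition GL_mul (g h : GL) := MkGL (GL_mul_subproof g h).

Fact GL_mulA : associative GL_mul.
Proof. by move=> f g h; apply/val_inj; rewrite /= mulmxA. Qed.
Fact GL_mul1 : left_id GL_one GL_mul.
Proof. by move=> g; apply/val_inj; rewrite /= mul1mx. Qed.
Fact GL_mulr1 : right_id GL_one GL_mul.
Proof. by move=> g; apply/val_inj; rewrite /= mulmx1. Qed.
Fact GL_mulV : left_inverse GL_one GL_inv GL_mul.
Proof. by move=> g; apply/val_inj; rewrite /= mulVmx ?GL_unit. Qed.
Fact GL_mulrV : right_inverse GL_one GL_inv GL_mul.
Proof. by move=> g; apply/val_inj; rewrite /= mulmxV ?GL_unit. Qed.

HB.instance Definition _ := isGroup.Build GL
  GL_mulA GL_mul1 GL_mulr1 GL_mulV GL_mulrV.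

Definition unipotent_upper : set GL :=
  [set g | forall i j : 'I_n, (j <= i)%N -> g i j = (i == j)%:R].

End GL.

Arguments unipotent_upper n R _ : clear implicits.

Section GLmap.
Variables (n : nat) (R S : comUnitRingType) (f : {rmorphism R -> S}).

Fact GL_map_subproof (g : GL n R) : map_mx f g \in unitmx.
Proof. by rewrite unitmxE det_map_mx rmorph_unit // -unitmxE GL_unit. Qed.

Definition GL_map (g : GL n R) : GL n S := MkGL (GL_map_subproof g).

End GLmap.

(* The topology on F is the one defined by the absolute value; the absolute
   value is not trivial, i.e., F is not discrete *)
HB.mixin Record isNonArchLocalField (R : realType) F
    of GRing.Field F & Topological F := {
  absF : F -> R;
  absF_ge0 : forall x, 0 <= absF x;
  absF_eq0 : forall x : F, absF x = 0 <-> x = 0;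
  absFM : forall x y : F, absF (x * y) = absF x * absF y;
  absFD : forall x y : F, absF (x + y) <= Num.max (absF x) (absF y);
  absF_nontrivial : exists2 x : F, x != 0 & absF x != 1;
  absF_nbhs : forall (x : F) (A : set F), nbhs x A <->
    exists2 e : R, 0 < e & [set y : F | absF (x - y) < e] `<=` A;
  locally_compactF : locally_compact [set: F]
}.

#[short(type="localFieldType")]
HB.structure Definition NonArchLocalField (R : realType) :=
  {F of isNonArchLocalField R F & GRing.Field F & Topological F}.

Section LocalField.
Variables (R : realType) (F : localFieldType R).

Lemma absF0 : absF (0 : F) = 0.
Proof. exact/absF_eq0. Qed.

Lemma absF_neq0 (x : F) : x != 0 -> absF x != 0.
Proof. by apply: contra_neq => /absF_eq0. Qed.

Lemma absF1 : absF (1 : F) = 1.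
Proof.
apply: (mulfI (absF_neq0 (oner_neq0 F))).
by rewrite -absFM !mulr1.
Qed.

Lemma absFV (x : F) : absF x^-1 = (absF x)^-1.
Proof.
have [->|x0] := eqVneq x 0; first by rewrite invr0 absF0 invr0.
apply: (mulfI (absF_neq0 x0)).
by rewrite -absFM divff // absF1 divff // absF_neq0.
Qed.

Lemma absFN1 : absF (-1 : F) = 1.
Proof.
have : absF (-1 : F) ^+ 2 = 1 by rewrite expr2 -absFM mulrNN mulr1 absF1.
by move/eqP; rewrite sqrp_eq1 ?absF_ge0 // => /eqP.
Qed.

Lemma absFN (x : F) : absF (- x) = absF x.
Proof. by rewrite -mulN1r absFM absFN1 mul1r. Qed.

Definition valring_pred : {pred F} := fun x => absF x <= 1.

Lemma valring_subring_closed : subring_closed valring_pred.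
Proof.
split=> [|x y xO yO|x y xO yO]; rewrite /in_mem /= /valring_pred.
- by rewrite absF1.
- by rewrite (le_trans (absFD _ _)) // ge_max absFN; apply/andP.
- by rewrite absFM mulr_ile1 // absF_ge0.
Qed.

HB.instance Definition _ := GRing.isSubringClosed.Build F valring_pred
  valring_subring_closed.

Record valring := ValRing { valring_val :> F; _ : valring_val \in valring_pred }.

HB.instance Definition _ := [isSub for valring_val].
HB.instance Definition _ := [Choice of valring by <:].
HB.instance Definition _ := [SubChoice_isSubComNzRing of valring by <:].

Lemma valringP (x : valring) : absF (valring_val x) <= 1.
Proof. exact: (valP x). Qed.

Definition valring_unit : {pred valring} := fun x => absF (valring_val x) == 1.

Fact valring_inv_subproof (x : valring) :
  (if absF (valring_val x) == 1 then (valring_val x)^-1 else valring_val x) \in valring_pred.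
Proof.
case: ifPn => [/eqP x1|_]; last exact: valP.
by rewrite /in_mem /= /valring_pred absFV x1 invr1.
Qed.

Definition valring_inv (x : valring) := ValRing (valring_inv_subproof x).

Fact valring_mulVx : {in valring_unit, left_inverse 1 valring_inv *%R}.
Proof.
move=> x x1; apply/val_inj => /=; rewrite (_ : _ == 1) // mulVf //.
by apply/eqP => /absF_eq0 /eqP; rewrite (eqP x1) oner_eq0.
Qed.

Fact valring_unitPl (x y : valring) : y * x = 1 -> valring_unit x.
Proof.
move/(congr1 (fun z : valring => absF (z : F))); rewrite /= absFM absF1 => yx.
rewrite /valring_unit eq_le valringP /= -yx ler_piMl ?absF_ge0 //.
exact: valringP.
Qed.

Fact valring_inv_out : {in [predC valring_unit], valring_inv =1 id}.
Proof. by move=> x /negbTE nx; apply/val_inj => /=; rewrite [_ == 1]nx. Qed.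

HB.instance Definition _ := GRing.ComNzRing_hasMulInverse.Build valring
  valring_mulVx valring_unitPl valring_inv_out.

Definition maxideal : {pred valring} := fun x => absF (valring_val x) < 1.

Lemma maxideal_idealr_closed : idealr_closed maxideal.
Proof.
split=> [||a x y xp yp]; rewrite /in_mem /= /maxideal /=.
- by rewrite absF0 ltr01.
- by rewrite absF1 ltxx.
- rewrite (le_lt_trans (absFD _ _)) // gt_max absFM; apply/andP; split=> //.
  by rewrite (le_lt_trans _ xp) // ler_piMl ?absF_ge0 ?valringP.
Qed.

HB.instance Definition _ := isIdealr.Build valring maxideal
  maxideal_idealr_closed.

Definition resfield : Type := {ideal_quot maxideal}.

HB.instance Definition _ := GRing.ComNzRing.on resfield.

Definition residue : valring -> resfield := \pi_{ideal_quot maxideal}.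

HB.instance Definition _ := GRing.RMorphism.on residue.

Definition resfield_inv (u : resfield) : resfield :=
  if u == 0 then 0 else residue (repr u)^-1.

Lemma residue_eq0 (x : valring) : (residue x == 0) = (x \in maxideal).
Proof.
by rewrite -[x in RHS]subr0 Quotient.idealrBE -(rmorph0 residue).
Qed.

Fact resfield_mulVf (u : resfield) : u != 0 -> resfield_inv u * u = 1.
Proof.
move=> u0; rewrite /resfield_inv (negbTE u0).
have ru : residue (repr u) = u := reprK u.
have xU : repr u \is a GRing.unit.
  have: residue (repr u) != 0 by rewrite ru.
  rewrite residue_eq0 /in_mem /= /maxideal -leNgt => u1.
  by change (is_true (absF (valring_val (repr u)) == 1)); rewrite eq_le valringP.
by rewrite -[X in _ * X]ru -rmorphM mulVr // rmorph1.
Qed.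

Fact resfield_invr0 : resfield_inv 0 = 0.
Proof. by rewrite /resfield_inv eqxx. Qed.

HB.instance Definition _ := GRing.ComNzRing_isField.Build resfield
  resfield_mulVf resfield_invr0.

Definition valring_incl : valring -> F := \val.
HB.instance Definition _ := GRing.RMorphism.on valring_incl.

End LocalField.

Arguments maxideal {R} F _.
Arguments residue {R} F _.
Arguments valring_incl {R} F _.

Section Subgroups.
Variables (n : nat) (R : realType) (F : localFieldType R).

Definition proIwahori : set (GL n F) :=
  [set GL_map (valring_incl F) g | g in
    [set g : GL n (valring F) | unipotent_upper n (resfield F) (GL_map (residue F) g)]].

Definition congruence1 : set (GL n F) :=
  [set g | exists2 X : 'M[valring F]_n,
     (forall i j, X i j \in maxideal F) & (g : 'M[F]_n) = 1%:M + map_mx (valring_incl F) X].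

End Subgroups.

Arguments proIwahori n {R} F _.
Arguments congruence1 n {R} F _.

(* Main.v *)
From HB Require Import structures.
Require Import Defs.
From mathcomp Require Import all_boot all_order perm all_algebra.
From mathcomp Require Import all_classical all_reals all_analysis.

(** Put K = GL_n(O), H = End_G(C) and calH = End(calC).  Inflating functions
    on G to K and extending them by zero identifies C with the functions of
    calC supported on K, and an endomorphism of C extends to one of calC, so
    that H is a subring of calH.

    The heart of the matter is a choice of representatives.  Every double
    coset I_1 g K has a representative g, called adapted below, for which
    g^-1 I_1 g meets K in a group whose reduction is exactly U.  For such a g
    the operator h_g of calH attached to I_1 g I_1 sends a function c in C to
    the function i g k |-> c(k) on I_1 g K, so it maps C bijectively onto the
    K_1-invariant functions supported on I_1 g K ([coef_hecke]).  Therefore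
    calC^{K_1} is the direct sum of the h_g C, calH is the direct sum of the
    h_g H as a right H-module, and for every right calH-module N the map
    N (x)_H C -> N (x)_calH calC^{K_1} is bijective ([tens_iota_inj],
    [tens_iota_surj]).

    If C is flat over H, this bijection, which is natural in N, shows at once
    that calC^{K_1} is flat.  Conversely, let N' -> N be an injection of right
    H-modules.  Coinduction N~ = Hom_H(calH, N) turns it into an injection of
    calH-modules, so flatness of calC^{K_1} makes N~' (x)_H C -> N~ (x)_H C
    injective.  Cutting an element of calH down to K is a retraction
    calH -> H of H-bimodules, through which N is a direct factor of N~ as an
    H-module, naturally in N; hence N' (x)_H C -> N (x)_H C is injective too.
    This is [flat_descent].

    Two facts about the local field remain.  An adapted representative is a
    monomial matrix whose nonzero entries are sorted by absolute value, ties
    being broken by the row index; it is reached by Gaussian elimination with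
    row operations in I_1 and column operations in K when each pivot is an
    entry of maximal absolute value taken in the lowest possible row
    ([adapted_ex]).  And local compactness gives O finite nets, so that each
    I_1 \ I_1 g K is finite and the functions above have finite support
    modulo I_1 ([rcos_proIwahori_fin]). *)

Set Implicit Arguments.
Unset Strict Implicit.
Unset Printing Implicit Defensive.

Import Order.TTheory GRing.Theory Num.Theory.
Local Open Scope classical_set_scope.
Local Open Scope ring_scope.

(** * Finitely supported sums and additive maps *)

Lemma fsumE (I : choiceType) (V : zmodType) (F : I -> V) (r : seq I) :
  uniq r -> (forall i, i \notin r -> F i = 0) ->
  \sum_(i \in [set: I]) F i = \sum_(i <- r) F i.
Proof.
move=> ur Fr; rewrite [RHS]fsbig_seq //; apply: esym.
rewrite (fsbig_widen [set` r] setT) // => i [_ /= /negP ir].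
exact: Fr.
Qed.

Lemma finite_set_seq (I : choiceType) (P : set I) : finite_set P ->
  exists2 r : seq I, uniq r & forall i, P i -> i \in r.
Proof.
move=> finP; exists (finmap.enum_fset (fset_set P)); first exact: finmap.fset_uniq.
by move=> i Pi; rewrite in_fset_set // inE.
Qed.

Lemma additive0 (V W : zmodType) (f : V -> W) : {morph f : u v / u + v} -> f 0 = 0.
Proof. by move=> fD; apply: (addIr (f 0)); rewrite add0r -fD add0r. Qed.

Lemma additive_sum (V W : zmodType) (f : V -> W) (I : Type) (r : seq I) (F : I -> V) :
  {morph f : u v / u + v} -> f (\sum_(i <- r) F i) = \sum_(i <- r) f (F i).
Proof.
move=> fD; elim: r => [|i r ih]; first by rewrite !big_nil additive0.
by rewrite !big_cons fD ih.
Qed.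

Lemma tens_ind (R : pzRingType) (X : lmodType R^c) (Y : lmodType R)
    (Q : tensor X Y -> Prop) :
  Q 0 -> (forall u v, Q u -> Q v -> Q (u + v)) -> (forall x y, Q (tens x y)) ->
  forall u, Q u.
Proof.
move=> Q0 QD Qt; elim/quotW=> s; rewrite tens_pi_sum.
by elim: s => [|p s ih]; rewrite ?big_nil // big_cons; apply: QD.
Qed.

(** * Restriction and coinduction of right modules *)

(** The morphism is part of the type, so that restrictions along different
    morphisms carry different module structures. *)
Definition restr_along (A B : pzRingType) (lam : A -> B) (N : lmodType B^c) :
  Type := N.

Section Restriction.
Variables (A B : pzRingType) (lam : {rmorphism A -> B}).


Section RestrictionModule.
Variable N : lmodType B^c.

HB.instance Definition _ := GRing.Zmodule.on (restr_along lam N).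

Definition restr_scale (a : A^c) (n : restr_along lam N) : restr_along lam N :=
  (lam a : B^c) *: (n : N).

Fact restr_scaleA a b n :
  restr_scale a (restr_scale b n) = restr_scale (a * b) n.
Proof.
by rewrite /restr_scale scalerA; congr (_ *: _); exact: esym (rmorphM lam b a).
Qed.
Fact restr_scale1 : left_id 1 restr_scale.
Proof. by move=> n; rewrite /restr_scale rmorph1 scale1r. Qed.
Fact restr_scaleDr : right_distributive restr_scale +%R.
Proof. by move=> a n n'; exact: scalerDr. Qed.
Fact restr_scaleDl n : {morph restr_scale^~ n : a b / a + b}.
Proof. by move=> a b; rewrite /restr_scale rmorphD scalerDl. Qed.

HB.instance Definition _ := GRing.Zmodule_isLmodule.Build A^c (restr_along lam N)
  restr_scaleA restr_scale1 restr_scaleDr restr_scaleDl.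
End RestrictionModule.

Variables (N' N : lmodType B^c) (f : {linear N' -> N}).

Definition restr_map (n : restr_along lam N') : restr_along lam N := f n.

Fact restr_map_linear : linear restr_map.
Proof. by move=> a x y; exact: linearP. Qed.

HB.instance Definition _ := GRing.isLinear.Build A^c
  (restr_along lam N') (restr_along lam N) _
  restr_map restr_map_linear.

Definition restr_linear : {linear restr_along lam N' -> restr_along lam N} :=
  restr_map.

End Restriction.
Arguments restr_linear {A B} lam {N' N} f.
Arguments restr_map {A B} lam {N' N} f n.

Section Coinduction.
Variables (A B : pzRingType) (lam : {rmorphism A -> B}).

Section CoinductionModule.
Variable N : lmodType A^c.

(** The right A-linear maps B -> N.  This functor, right adjoint to the
    restriction along [lam], preserves injections for every [lam]; extension
    of scalars does so only if B is flat as a left A-module. *)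
Definition coind_pred : {pred (B -> N)} := fun f =>
  `[< {morph f : x y / x + y} /\
      forall x a, f (x * lam a) = (a : A^c) *: f x >].

Fact coind_zmod_closed : zmod_closed coind_pred.
Proof.
split=> [|f g /asboolP[fD fZ] /asboolP[gD gZ]]; apply/asboolP; split.
- by move=> x y; rewrite /GRing.zero /= addr0.
- by move=> x a; rewrite /GRing.zero /= scaler0.
- by move=> x y; rewrite /GRing.add /GRing.opp /= fD gD opprD addrACA.
- by move=> x a; rewrite /GRing.add /GRing.opp /= fZ gZ scalerBr.
Qed.

HB.instance Definition _ := GRing.isZmodClosed.Build (B -> N) coind_pred
  coind_zmod_closed.

Record coind := Coind { coind_fun :> B -> N; _ : coind_fun \in coind_pred }.

HB.instance Definition _ := [isSub for coind_fun].
HB.instance Definition _ := [Choice of coind by <:].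
HB.instance Definition _ := [SubChoice_isSubZmodule of coind by <:].

Lemma coindD (f : coind) : {morph f : x y / x + y}.
Proof. by case: f => f /= /asboolP[]. Qed.

Lemma coindZ (f : coind) x a : f (x * lam a) = (a : A^c) *: f x.
Proof. by case: f => f /= /asboolP[]. Qed.

Fact coind_scale_subproof (x : B) (f : coind) :
  (fun y => f (x * y)) \in coind_pred.
Proof.
apply/asboolP; split=> [y z|y a]; first by rewrite mulrDr coindD.
by rewrite mulrA coindZ.
Qed.

Definition coind_scale (x : B^c) (f : coind) := Coind (coind_scale_subproof x f).

Fact coind_scaleA x y f :
  coind_scale x (coind_scale y f) = coind_scale (x * y) f.
Proof. by apply/val_inj/funext => z /=; rewrite mulrA. Qed.
Fact coind_scale1 : left_id 1 coind_scale.
Proof. by move=> f; apply/val_inj/funext => z /=; rewrite mul1r. Qed.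
Fact coind_scaleDr : right_distributive coind_scale +%R.
Proof. by move=> x f g; apply/val_inj/funext. Qed.
Fact coind_scaleDl f : {morph coind_scale^~ f : x y / x + y}.
Proof.
by move=> x y; apply/val_inj/funext => z /=; rewrite mulrDl coindD.
Qed.

HB.instance Definition _ := GRing.Zmodule_isLmodule.Build B^c coind
  coind_scaleA coind_scale1 coind_scaleDr coind_scaleDl.

End CoinductionModule.

Section CoinductionMap.
Variables (N' N : lmodType A^c) (f : {linear N' -> N}).

Fact coind_map_subproof (g : coind N') : (fun x => f (g x)) \in @coind_pred N.
Proof.
apply/asboolP; split=> [x y|x a]; first by rewrite coindD linearD.
by rewrite coindZ linearZ.
Qed.

Definition coind_map (g : coind N') : coind N := Coind (coind_map_subproof g).

Fact coind_map_linear : linear coind_map.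
Proof. by move=> x g h; apply/val_inj/funext => y /=; rewrite linearD. Qed.

HB.instance Definition _ := GRing.isLinear.Build B^c (coind N') (coind N) _
  coind_map coind_map_linear.

Lemma coind_map_inj : injective f -> injective coind_map.
Proof.
move=> finj g h /(congr1 val) /= gh; apply/val_inj/funext => x.
by apply: finj; exact: (congr1 (@^~ x) gh).
Qed.
End CoinductionMap.

Variable N : lmodType A^c.

Definition coind_eval1 (g : restr_along lam (coind N)) : N := (g : coind N) 1.

Fact coind_eval1_linear : linear coind_eval1.
Proof.
move=> a g h; rewrite /coind_eval1 /=; congr (_ + _).
by rewrite mulr1 -[lam a]mul1r coindZ.
Qed.

HB.instance Definition _ := GRing.isLinear.Build A^c (restr_along lam (coind N)) N _
  coind_eval1 coind_eval1_linear.

Variables (ret : B -> A).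
Hypotheses (retD : {morph ret : x y / x + y}).
Hypotheses (ret_l : forall a x, ret (lam a * x) = a * ret x).
Hypotheses (ret_r : forall x a, ret (x * lam a) = ret x * a).

Fact coind_sec_subproof (n : N) :
  (fun x => (ret x : A^c) *: n) \in @coind_pred N.
Proof.
apply/asboolP; split=> [x y|x a]; first by rewrite retD scalerDl.
by rewrite ret_r scalerA.
Qed.

(** As [ret] is A-linear on both sides, this map is well defined and
    A-linear; [ret 1 = 1] makes [coind_eval1] a retraction of it. *)
Definition coind_sec (n : N) : restr_along lam (coind N) :=
  Coind (coind_sec_subproof n).

Fact coind_sec_linear : linear coind_sec.
Proof.
move=> a n n'; apply/val_inj/funext => x /=.
rewrite [LHS]scalerDr [in LHS]scalerA; congr (_ + _).
by rewrite -[RHS]/((ret (lam a * x) : A^c) *: n) ret_l.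
Qed.
End Coinduction.
Arguments coind_map {A B} lam {N' N} f g.
Arguments coind_eval1 {A B} lam N g.

(** * Descent of flatness along a split ring morphism *)

Section FlatDescent.
Variables (A B : pzRingType) (lam : {rmorphism A -> B}).
Variables (M : lmodType A) (P : lmodType B) (iota : M -> P).
Hypotheses (iotaD : {morph iota : x y / x + y}).
Hypotheses (iotaZ : forall a m, iota (a *: m) = lam a *: iota m).

Section Tens.
Variable N : lmodType B^c.

Fact tens_iota_balanced :
  balanced (fun (n : restr_along lam N) (m : M) => tens (n : N) (iota m)).
Proof.
have [tDl tDr tZ] := tens_balanced N P.
split=> [x x' y|x y y'|a x y]; first exact: tDl.
  by rewrite iotaD tDr.
by rewrite iotaZ -tZ.
Qed.

Definition tens_iota : tensor (restr_along lam N) M -> tensor N P :=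
  tens_lift (fun (n : restr_along lam N) (m : M) => tens (n : N) (iota m)).

Lemma tens_iotaE n m : tens_iota (tens n m) = tens (n : N) (iota m).
Proof. by rewrite /tens_iota tens_lift_pi ?big_seq1 //; exact: tens_iota_balanced. Qed.

Lemma tens_iotaD : {morph tens_iota : u v / u + v}.
Proof. exact/tens_liftD/tens_iota_balanced. Qed.
End Tens.

Lemma tens_iota_natural (N' N : lmodType B^c) (f : {linear N' -> N}) u :
  tens_map P f (tens_iota u) = tens_iota (tens_map M (restr_linear lam f) u).
Proof.
elim/tens_ind: u => [|u v ihu ihv|x y].
- rewrite (additive0 (@tens_iotaD N')) !(additive0 (tens_mapD _)).
  by rewrite (additive0 (@tens_iotaD N)).
- by rewrite tens_iotaD !tens_mapD tens_iotaD ihu ihv.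
- by rewrite tens_iotaE !tens_mapE tens_iotaE.
Qed.

(** The [c i] are coordinates for a decomposition of P as the sum of the
    [h i *: iota M], the [b i] for one of B as the sum of the right A-modules
    [h i * lam A]; [c_b] makes them compatible. *)
Variables (I : choiceType) (h : I -> B) (c : I -> P -> M) (b : I -> B -> A).
Hypotheses (cD : forall i, {morph c i : p q / p + q}).
Hypotheses (c_fin : forall p, finite_set [set i | c i p != 0]).
Hypotheses (b_fin : forall x, finite_set [set i | b i x != 0]).
Hypotheses (c_sum : forall p, p = \sum_(i \in [set: I]) h i *: iota (c i p)).
Hypotheses (b_sum : forall x, x = \sum_(i \in [set: I]) h i * lam (b i x)).
Hypotheses (c_b : forall i x m, c i (x *: iota m) = b i x *: m).

Section TensRet.
Variable N : lmodType B^c.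

Let tDl : forall (R : pzRingType) (X : lmodType R^c) (Y : lmodType R) (y : Y),
  {morph (fun x : X => tens x y) : u v / u + v}.
Proof. by move=> R X Y y u v; case: (tens_balanced X Y). Qed.
Let tDr (R : pzRingType) (X : lmodType R^c) (Y : lmodType R) (x : X) :
  {morph (fun y : Y => tens x y) : u v / u + v}.
Proof. by move=> u v; case: (tens_balanced X Y). Qed.
Let tZ (R : pzRingType) (X : lmodType R^c) (Y : lmodType R) (a : R) (x : X) (y : Y) :
  tens ((a : R^c) *: x) y = tens x (a *: y).
Proof. by case: (tens_balanced X Y). Qed.

(** On pure tensors, the inverse of [tens_iota]: p is replaced by its
    expansion in the decomposition of P. *)
Definition coef_tens (n : N) (p : P) : tensor (restr_along lam N) M :=
  \sum_(i \in [set: I]) tens ((h i : B^c) *: n : restr_along lam N) (c i p).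

Lemma coef_tensE (r : seq I) n p : uniq r ->
  (forall i, c i p != 0 -> i \in r) ->
  coef_tens n p =
  \sum_(i <- r) tens ((h i : B^c) *: n : restr_along lam N) (c i p).
Proof.
move=> ur cr; apply: fsumE => // i /negP ir.
have [->|/cr//] := eqVneq (c i p) 0; exact: (additive0 (tDr _)).
Qed.

Lemma coef_tensD n p q : coef_tens n (p + q) = coef_tens n p + coef_tens n q.
Proof.
have [r ur rE] := finite_set_seq (c_fin p).
have [s us sE] := finite_set_seq (c_fin q).
have ut : uniq (undup (r ++ s)) := undup_uniq _.
rewrite !(@coef_tensE (undup (r ++ s))) //; first last.
- move=> i; rewrite mem_undup mem_cat cD => cpq; apply/orP.
  have [c0|/rE ->] := eqVneq (c i p) 0; last by left.
  by right; apply: sE => /=; rewrite c0 add0r in cpq.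
- by move=> i /rE; rewrite mem_undup mem_cat => ->.
- by move=> i /sE; rewrite mem_undup mem_cat orbC => ->.
by rewrite -big_split; apply: eq_bigr => i _; rewrite cD tDr.
Qed.

Lemma coef_tensDl n n' p : coef_tens (n + n') p = coef_tens n p + coef_tens n' p.
Proof.
have [r ur rE] := finite_set_seq (c_fin p).
rewrite !(@coef_tensE r) // -big_split; apply: eq_bigr => i _.
by rewrite scalerDr; exact: tDl.
Qed.

(** The coordinates of [x *: iota m] are the [b i x *: m]; carrying the
    [b i x] across the tensor sign reassembles x on the left. *)
Lemma coef_tens_iota n x m :
  coef_tens n (x *: iota m) = tens ((x : B^c) *: n : restr_along lam N) m.
Proof.
have [r ur rE] := finite_set_seq (b_fin x).
have r0 i : i \notin r -> b i x = 0.
  by move=> /negP ir; have [//|/rE] := eqVneq (b i x) 0.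
rewrite (@coef_tensE r) //; last first.
  move=> i; rewrite c_b => bm; apply: rE => /=.
  by apply: contra_neq bm => ->; rewrite scale0r.
rewrite [in RHS](b_sum x) (@fsumE _ _ _ r) // => [|i /r0 ->]; last first.
  by rewrite rmorph0 mulr0.
have -> : (\sum_(i <- r) h i * lam (b i x) : B^c) *: n =
    \sum_(i <- r) ((h i * lam (b i x) : B) : B^c) *: n.
  exact: (additive_sum _ _ (fun u v : B^c => scalerDl n u v)).
rewrite (additive_sum _ _ (tDl m)); apply: eq_bigr => i _.
by rewrite c_b -tZ; congr tens; rewrite [LHS]scalerA.
Qed.

(** To move a scalar across, expand p and treat each term by
    [coef_tens_iota]. *)
Fact coef_tens_balanced : balanced coef_tens.
Proof.
split=> [x x' y|x y y'|y n p]; first exact: coef_tensDl.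
  exact: coef_tensD.
have [r ur rE] := finite_set_seq (c_fin p).
have r0 i : i \notin r -> c i p = 0.
  by move=> /negP ir; have [//|/rE] := eqVneq (c i p) 0.
have iota0 : iota 0 = 0 := additive0 iotaD.
rewrite (@coef_tensE r) // [in RHS](c_sum p) (@fsumE _ _ _ r) //; last first.
  by move=> i /r0 ->; rewrite iota0 scaler0.
rewrite scaler_sumr (additive_sum _ _ (coef_tensD n)); apply: eq_bigr => i _.
by rewrite [in RHS]scalerA coef_tens_iota scalerA.
Qed.

Lemma tens_iota_inj : injective (@tens_iota N).
Proof.
apply: (can_inj (g := tens_lift coef_tens)) => u.
have lD := tens_liftD coef_tens_balanced.
elim/tens_ind: u => [|u v ihu ihv|n m].
- by rewrite (additive0 (@tens_iotaD N)) (additive0 lD).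
- by rewrite tens_iotaD lD ihu ihv.
rewrite tens_iotaE tens_lift_pi ?big_seq1 /=; last exact: coef_tens_balanced.
by rewrite -[iota m]scale1r coef_tens_iota scale1r.
Qed.

Lemma tens_iota_surj (u : tensor N P) : exists v, tens_iota v = u.
Proof.
elim/tens_ind: u => [|u v [u' <-] [v' <-]|n p].
- by exists 0; exact: (additive0 (@tens_iotaD N)).
- by exists (u' + v'); rewrite tens_iotaD.
exists (coef_tens n p).
have [r ur rE] := finite_set_seq (c_fin p).
have r0 i : i \notin r -> c i p = 0.
  by move=> /negP ir; have [//|/rE] := eqVneq (c i p) 0.
have iota0 : iota 0 = 0 := additive0 iotaD.
rewrite (@coef_tensE r) // [in RHS](c_sum p) (@fsumE _ _ _ r) //; last first.
  by move=> i /r0 ->; rewrite iota0 scaler0.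
rewrite (additive_sum _ _ (tDr n)) (additive_sum _ _ (@tens_iotaD N)).
by apply: eq_bigr => i _; rewrite tens_iotaE tZ.
Qed.

End TensRet.

Variables (ret : B -> A).
Hypotheses (retD : {morph ret : x y / x + y}).
Hypotheses (ret1 : ret 1 = 1).
Hypotheses (ret_l : forall a x, ret (lam a * x) = a * ret x).
Hypotheses (ret_r : forall x a, ret (x * lam a) = ret x * a).

(** From P to M, an injection f of right A-modules is compared with its
    coinduction, an injection of B-modules, through the natural sections of
    [coind_eval1].  From M to P, an injection of B-modules is restricted to A
    and [tens_iota] identifies the two tensor products. *)
Theorem flat_descent : flat B P <-> flat A M.
Proof.
split=> [flatP N' N f finj|flatM N' N f finj].
  pose f' : {linear coind lam N' -> coind lam N} := coind_map lam f.
  pose s (X : lmodType A^c) : {linear X -> restr_along lam (coind lam X)} :=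
    HB.pack (coind_sec retD ret_r (N := X))
      (GRing.isLinear.Build _ _ _ _ _ (coind_sec_linear retD ret_l ret_r)).
  pose ev (X : lmodType A^c) : {linear restr_along lam (coind lam X) -> X} :=
    coind_eval1 lam X.
  have sK (X : lmodType A^c) : cancel (tens_map M (s X)) (tens_map M (ev X)).
    move=> u; elim/tens_ind: u => [|u v ihu ihv|n m].
    - by rewrite !(additive0 (tens_mapD _)).
    - by rewrite !tens_mapD ihu ihv.
    - by rewrite !tens_mapE /coind_eval1 /= ret1 scale1r.
  have sf u : tens_map M (restr_linear lam f') (tens_map M (s N') u) =
      tens_map M (s N) (tens_map M f u).
    elim/tens_ind: u => [|u v ihu ihv|n m].
    - by rewrite !(additive0 (tens_mapD _)).
    - by rewrite !tens_mapD ihu ihv.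
    rewrite !tens_mapE; congr tens; apply/val_inj/funext => x /=.
    by rewrite linearZ.
  have f'inj : injective (tens_map M (restr_linear lam f')).
    move=> u v uv; apply: tens_iota_inj.
    apply: (flatP _ _ _ (coind_map_inj finj)).
    by rewrite !tens_iota_natural uv.
  by move=> u v uv; apply: (can_inj (sK N')); apply: f'inj; rewrite !sf uv.
move=> u v.
have [u' <-] := tens_iota_surj u; have [v' <-] := tens_iota_surj v.
rewrite !tens_iota_natural => /tens_iota_inj uv; congr tens_iota.
exact: (flatM (restr_along lam N') (restr_along lam N) (restr_linear lam f) finj).
Qed.

End FlatDescent.

(** * Frobenius reciprocity for compact induction *)

Section Frobenius.
Variables (K : fieldType) (G : groupType) (S : set G).
Hypotheses (S1 : S 1%g) (SM : forall s t, S s -> S t -> S (s * t)%g).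
Hypotheses (SV : forall s, S s -> S s^-1%g).

Definition rcos (x : G) : set G := [set (s * x)%g | s in S].

Lemma rcos_mull s x : S s -> rcos (s * x)%g = rcos x.
Proof.
move=> Ss; apply/seteqP; split=> [_ [t St <-]|_ [t St <-]].
  by exists (t * s)%g; rewrite ?mulgA //; exact: SM.
by exists (t * s^-1)%g; rewrite -?mulgA ?mulKg //; apply: SM => //; exact: SV.
Qed.

Lemma rcos_refl x : rcos x x.
Proof. by exists 1%g; rewrite ?mul1g. Qed.

(** One point is chosen in each coset of [S \ G], so that sums over the
    cosets become sums over the fixed points of [crep]. *)
Definition crep (x : G) : G := xget 1%g (rcos x).

Lemma crepP x : exists2 s, S s & crep x = (s * x)%g.
Proof.
have : rcos x (crep x) by apply: xgetPex; exists x; exact: rcos_refl.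
by case=> s Ss <-; exists s.
Qed.

Lemma crep_mull s x : S s -> crep (s * x)%g = crep x.
Proof. by move=> Ss; rewrite /crep rcos_mull. Qed.

Lemma crepK x : crep (crep x) = crep x.
Proof. by have [s Ss e] := crepP x; rewrite {1}e crep_mull. Qed.

Lemma cind_mull (f : cind K S) s x : S s -> f (s * x)%g = f x.
Proof. by case: f => f /= /asboolP[fS _]; exact: fS. Qed.

Lemma cind_crep (f : cind K S) x : f (crep x) = f x.
Proof. by have [s Ss ->] := crepP x; exact: cind_mull. Qed.

Lemma cind_supp (f : cind K S) :
  exists r : seq G, [/\ uniq r, forall x, x \in r -> crep x = x &
    forall x, crep x = x -> f x != 0 -> x \in r].
Proof.
have finA : finite_set [set x | crep x = x /\ f x != 0].
  have [_ fin] : is_cind S f by case: (f) => f' /= /asboolP.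
  apply: (sub_finite_set _ (finite_image (xget 1%g) fin)) => x /= [xr fx].
  by exists (rcos x) => //; exists x.
have [r ur rE] := finite_set_seq finA.
exists [seq x <- r | crep x == x]; split; first exact: filter_uniq.
  by move=> x; rewrite mem_filter => /andP[/eqP].
by move=> x xr fx; rewrite mem_filter xr eqxx rE.
Qed.

Variables (V : lmodType K) (rho : repType V G) (v : V).
Hypothesis (vS : forall s, S s -> rho s v = v).

(** The morphism of representations that corresponds to the S-invariant
    vector v: it sends the indicator function of S to v. *)
Definition frob (f : cind K S) : V :=
  \sum_(x \in [set: G]) (if crep x == x then f x *: rho x^-1%g v else 0).

Lemma frobE (r : seq G) (f : cind K S) : uniq r ->
  (forall x, x \in r -> crep x = x) ->
  (forall x, crep x = x -> f x != 0 -> x \in r) ->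
  frob f = \sum_(x <- r) f x *: rho x^-1%g v.
Proof.
move=> ur rQ rf; rewrite /frob (@fsumE _ _ _ r) // => [|x /negP xr].
  by rewrite [LHS]big_seq [RHS]big_seq; apply: eq_bigr => x /rQ ->; rewrite eqxx.
case: eqP => // xx; have [->|fx] := eqVneq (f x) 0; first by rewrite scale0r.
by case: xr; exact: rf.
Qed.

Lemma frob_linear : linear frob.
Proof.
move=> a f g.
have [r [ur rQ rf]] := cind_supp f; have [s [us sQ sf]] := cind_supp g.
have ut := undup_uniq (r ++ s).
have tQ x : x \in undup (r ++ s) -> crep x = x.
  by rewrite mem_undup mem_cat => /orP[/rQ|/sQ].
rewrite !(frobE ut tQ); first last.
- move=> x xx afg; rewrite mem_undup mem_cat; apply/orP.
  have [f0|fx] := eqVneq (f x) 0; last by left; exact: rf.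
  right; apply: sf => //; apply: contra_neq afg => g0.
  by rewrite /= /GRing.add /GRing.scale /= f0 g0 scaler0 addr0.
- by move=> x xx fx; rewrite mem_undup mem_cat rf.
- by move=> x xx fx; rewrite mem_undup mem_cat sf ?orbT.
rewrite scaler_sumr -big_split; apply: eq_bigr => x _ /=.
by rewrite scalerA -scalerDl.
Qed.

(** Translation by y permutes the cosets; it moves their chosen points by
    factors in S, which fix v. *)
Lemma frob_equiv y f : frob (cind_rep K S y f) = rho y (frob f).
Proof.
have [r [ur rQ rf]] := cind_supp f.
pose t x := crep (x * y^-1)%g.
have tE x : exists2 s, S s & t x = (s * (x * y^-1))%g by exact: crepP.
rewrite (frobE ur rQ rf) (@frobE (map t r)).
- rewrite big_map linear_sum; apply: eq_bigr => x _ /=.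
  have [s Ss ->] := tE x.
  rewrite linearZ /= /rtrans -!mulgA mulVg mulg1 cind_mull //.
  by rewrite !invgM invgK !repM vS //; exact: SV.
- rewrite map_inj_in_uniq // => x z /rQ xx /rQ zz txz.
  have [s Ss e] := tE x; have [s' Ss' e'] := tE z.
  rewrite -xx -zz -(crep_mull x Ss) -(crep_mull z Ss'); congr crep.
  by apply: (mulIg y^-1%g); rewrite -!mulgA -e -e'.
- by move=> _ /mapP[x _ ->]; rewrite crepK.
move=> z zz /= fz; apply/mapP; exists (crep (z * y)%g).
  by apply: rf; rewrite ?crepK // cind_crep.
have [s Ss e] := crepP (z * y)%g.
by rewrite /t e -!mulgA mulgV mulg1 crep_mull.
Qed.

End Frobenius.

(** * Hecke operators and the invariants under the kernel of reduction *)

Section Parahoric.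
(** [Kg] stands for GL_n(O), with its inclusion in GL_n(F), [Gt], and its
    reduction onto GL_n of the residue field, [Gb]. *)
Variables (K : fieldType) (Gt Kg Gb : groupType).
Variables (inc : Kg -> Gt) (red : Kg -> Gb) (U : set Gb) (K1 : set Gt).
Hypotheses (incM : {morph inc : x y / (x * y)%g}) (inc_inj : injective inc).
Hypotheses (redM : {morph red : x y / (x * y)%g}).
Hypothesis (red_surj : forall x, exists k, red k = x).
Hypotheses (U1 : U 1%g) (UM : forall x y, U x -> U y -> U (x * y)%g).
Hypothesis (UV : forall x, U x -> U x^-1%g).
Hypothesis (K1E : forall x, K1 x <-> exists2 k, red k = 1%g & x = inc k).

Let I1 : set Gt := [set inc k | k in [set k | U (red k)]].

Hypothesis fin : forall g, finite_set [set rcos I1 (g * inc k)%g | k in [set: Kg]].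

(** The intersection of K with the conjugate of I_1 by g^-1 has reduction
    contained in U (first clause) and containing U (second clause). *)
Definition adapted (g : Gt) : Prop :=
  (forall k, I1 (g * inc k * g^-1)%g -> U (red k)) /\
  (forall u, U u -> exists2 k, red k = u & I1 (g * inc k * g^-1)%g).

Hypothesis adapted_ex : forall x, exists s k, I1 s /\ adapted (s * x * inc k)%g.

Lemma inc1 : inc 1%g = 1%g.
Proof. by apply: (mulgI (inc 1%g)); rewrite -incM !mulg1. Qed.
Lemma incV k : inc k^-1%g = (inc k)^-1%g.
Proof. by apply: (mulgI (inc k)); rewrite -incM !mulgV inc1. Qed.
Lemma red1 : red 1%g = 1%g.
Proof. by apply: (mulgI (red 1%g)); rewrite -redM !mulg1. Qed.
Lemma redV k : red k^-1%g = (red k)^-1%g.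
Proof. by apply: (mulgI (red k)); rewrite -redM !mulgV red1. Qed.

Lemma I1_inc k : I1 (inc k) <-> U (red k).
Proof. by split=> [[l Ul /inc_inj <-]|Uk]; last exists k. Qed.

Lemma I1_1 : I1 1%g.
Proof. by rewrite -inc1; apply/I1_inc; rewrite red1. Qed.
Lemma I1_M s t : I1 s -> I1 t -> I1 (s * t)%g.
Proof.
move=> [k /= Uk <-] [l /= Ul <-]; rewrite -incM; apply/I1_inc.
by rewrite redM; exact: UM.
Qed.
Lemma I1_V s : I1 s -> I1 s^-1%g.
Proof.
by move=> [k /= Uk <-]; rewrite -incV; apply/I1_inc; rewrite redV; exact: UV.
Qed.

Definition lift (x : Gb) : Kg := xget 1%g [set k | red k = x].
Lemma liftK x : red (lift x) = x.
Proof. exact: (xgetPex 1%g (red_surj x)). Qed.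

Local Notation cC := (cind_rep K I1).
Local Notation C := (ind_rep K U).
Local Notation tX := (cind K I1).
Local Notation X := (ind K U).

Lemma tX_mull (f : tX) s x : I1 s -> f (s * x)%g = f x.
Proof. exact: cind_mull. Qed.

Lemma X_mull (c : X) u x : U u -> c (u * x)%g = c x.
Proof. by case: c => c /= /asboolP cU; exact: cU. Qed.

(** The kernel of the reduction lies in I_1 and is normal in K; hence
    functions on K that are invariant on the left under I_1 factor through the
    reduction. *)
Lemma tX_inc (f : tX) k l : red k = red l -> f (inc k) = f (inc l).
Proof.
move=> kl; rewrite -[k](mulgVK l) incM tX_mull //; apply/I1_inc.
by rewrite redM redV kl mulgV.
Qed.

Fact res_subproof (f : tX) : (fun x => f (inc (lift x))) \in @ind_pred K Gb U.
Proof.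
apply/asboolP => u x Uu; rewrite (@tX_inc _ _ (lift u * lift x)%g).
  by rewrite incM tX_mull //; apply/I1_inc; rewrite liftK.
by rewrite redM !liftK.
Qed.

Definition res (f : tX) : X := Ind (res_subproof f).

Lemma resE f k : res f (red k) = f (inc k).
Proof. by apply: tX_inc; rewrite liftK. Qed.

Lemma res_linear : linear res.
Proof. by move=> a f g; apply/val_inj. Qed.

Lemma res_equiv k f : res (cC (inc k) f) = C (red k) (res f).
Proof.
apply/val_inj/funext => x /=; rewrite /rtrans -incM.
by apply: tX_inc; rewrite redM !liftK.
Qed.

Definition infl_fun (c : X) (g : Gt) : K^o :=
  if `[< exists k, inc k = g >] then c (red (xget 1%g [set k | inc k = g])) else 0.

Lemma infl_inc c k : infl_fun c (inc k) = c (red k).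
Proof.
rewrite /infl_fun asboolT; last by exists k.
by case: xgetP => [l _ /= /inc_inj <- //|/(_ k) []].
Qed.

Lemma infl_out c g : (forall k, inc k <> g) -> infl_fun c g = 0.
Proof. by move=> ng; rewrite /infl_fun asboolF // => -[k /ng]. Qed.

Lemma infl_funP (c : X) (g : Gt) :
  (exists2 k, g = inc k & infl_fun c g = c (red k)) \/
  (forall k, inc k <> g) /\ infl_fun c g = 0.
Proof.
have [[k <-]|ng] := pselect (exists k, inc k = g).
  by left; exists k; rewrite ?infl_inc.
have ng' k : inc k <> g by move=> e; apply: ng; exists k.
by right; split; rewrite ?infl_out.
Qed.

Fact infl_subproof (c : X) : infl_fun c \in @cind_pred K Gt I1.
Proof.
apply/asboolP; split.
  move=> _ g [k /= Uk <-].
  have [[l -> ->]|[ng ->]] := infl_funP c g.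
    by rewrite -incM infl_inc redM X_mull.
  by apply: infl_out => l e; apply: (ng (k^-1 * l)%g); rewrite incM incV e mulKg.
apply: (sub_finite_set _ (fin 1%g)) => _ [g /= cg <-].
have [[k -> _]|[_ c0]] := infl_funP c g; last by rewrite c0 eqxx in cg.
by exists k; rewrite ?mul1g.
Qed.

Definition infl (c : X) : tX := CInd (infl_subproof c).

Lemma inflE c k : infl c (inc k) = c (red k).
Proof. exact: infl_inc. Qed.

Lemma infl_linear : linear infl.
Proof.
move=> a c d; apply/val_inj/funext => g /=.
have [[k -> _]|[ng ->]] := infl_funP (a *: c + d) g.
  by rewrite infl_inc /GRing.add /GRing.scale /= !infl_inc.
by rewrite /GRing.add /GRing.scale /= !infl_out // scaler0 addr0.
Qed.

Lemma infl_equiv k c : infl (C (red k) c) = cC (inc k) (infl c).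
Proof.
apply/val_inj/funext => g /=; rewrite /rtrans.
have [[l -> ->]|[ng ->]] := infl_funP (C (red k) c) g.
  by rewrite -incM infl_inc redM.
rewrite infl_out // => l e; apply: (ng (l * k^-1)%g).
by rewrite incM incV e mulgK.
Qed.

Lemma res_infl c : res (infl c) = c.
Proof. by apply/val_inj/funext => x /=; rewrite infl_inc liftK. Qed.

Definition indic (T : Type) (A : set T) (x : T) : K^o :=
  if `[< A x >] then 1 else 0.

Lemma indicT (T : Type) (A : set T) x : A x -> indic A x = 1.
Proof. by move=> Ax; rewrite /indic asboolT. Qed.
Lemma indicF (T : Type) (A : set T) x : ~ A x -> indic A x = 0.
Proof. by move=> Ax; rewrite /indic asboolF. Qed.

Fact indicU_subproof : indic U \in @ind_pred K Gb U.
Proof.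
apply/asboolP => u y Uu; congr (if _ then _ else _); apply: asbool_equiv_eq.
split=> [Uuy|]; last exact: UM.
by rewrite -[y](mulKg u); apply: UM => //; exact: UV.
Qed.

Definition indicU : X := Ind indicU_subproof.

(** calC is compactly induced from the representation C of K; this is the
    endomorphism that induction attaches to [phi]. *)
Definition ext_end_fun (phi : gend C) (f : tX) : Gt -> K^o :=
  fun g => phi (res (cC g f)) 1%g.

(** The support lies in K supp f, and by [fin] each K y consists of finitely
    many cosets of I_1. *)
Fact ext_end_fun_subproof phi f : ext_end_fun phi f \in @cind_pred K Gt I1.
Proof.
apply/asboolP; split.
  move=> _ g [k /= Uk <-]; rewrite /ext_end_fun cind_repM res_equiv gend_rep /=.
  by rewrite /rtrans mul1g -[red k]mulg1 X_mull.
have [_ finf] : is_cind I1 f by case: (f) => f' /= /asboolP.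
pose F (A : set Gt) := [set [set (t * xget 1%g A)%g | t in B] |
  B in [set rcos I1 (1%g * inc k)%g | k in [set: Kg]]].
have finF : finite_set (\bigcup_(A in _) F A) :=
  bigcup_finite finf (fun A _ => finite_image _ (fin 1%g)).
apply: (sub_finite_set _ finF).
move=> _ [g /= fg <-].
have [k fk] : exists k, f (inc k * g)%g != 0.
  apply/not_existsP => f0; move/eqP: fg; apply; rewrite /ext_end_fun.
  rewrite (_ : res _ = 0) ?linear0 //; apply/val_inj/funext => x /=.
  by have /negP/negPn/eqP := f0 (lift x).
exists (rcos I1 (inc k * g)%g); first by exists (inc k * g)%g.
set A := rcos I1 _; have [s I1s sE] : exists2 s, I1 s & (s * (inc k * g))%g = xget 1%g A.
  have : A (xget 1%g A) by apply: xgetPex; exists (inc k * g)%g; exact: rcos_refl I1_1 _.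
  by case=> s I1s <-; exists s.
case: I1s sE => l Ul <- sE.
exists (rcos I1 (inc (l * k)^-1%g)).
  by exists (l * k)^-1%g; rewrite ?mul1g.
rewrite -sE; apply/seteqP; split=> [_ [_ [t I1t <-] <-]|_ [t I1t <-]].
  by exists t => //; rewrite incV !mulgA -[in RHS](mulgA _ (inc l)) -incM mulgVK.
exists (t * inc (l * k)^-1)%g; first by exists t.
by rewrite incV !mulgA -[in LHS](mulgA _ (inc l)) -incM mulgVK.
Qed.

Definition ext_end_cind phi f : tX := CInd (ext_end_fun_subproof phi f).

Fact ext_end_subproof phi : ext_end_cind phi \in gend_pred cC.
Proof.
apply/asboolP; split=> [a f g|g f]; apply/val_inj/funext => y /=.
  by rewrite /ext_end_fun cind_rep_linear res_linear linearP.
by rewrite /ext_end_fun /rtrans /= -cind_repM.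
Qed.

Definition ext_end phi : gend cC := Gend (ext_end_subproof phi).

Lemma res_ext_end phi f : res (ext_end phi f) = phi (res f).
Proof.
apply/val_inj/funext => x /=; rewrite /ext_end_fun res_equiv gend_rep liftK /=.
by rewrite /rtrans mul1g.
Qed.

Lemma ext_end_infl phi c : ext_end phi (infl c) = infl (phi c).
Proof.
apply/val_inj/funext => g /=; rewrite /ext_end_fun.
have [[k -> ->]|[ng ->]] := infl_funP (phi c) g.
  by rewrite res_equiv res_infl gend_rep /= /rtrans mul1g.
rewrite (_ : res _ = 0) ?linear0 //; apply/val_inj/funext => x /=.
rewrite /rtrans infl_out // => k e; apply: (ng ((lift x)^-1 * k)%g).
by rewrite incM incV e mulKg.
Qed.

Fact ext_end_zmod : zmod_morphism ext_end.
Proof. by move=> phi psi; apply/val_inj/funext => f; apply/val_inj/funext. Qed.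

Fact ext_end_monoid : monoid_morphism ext_end.
Proof.
split=> [|phi psi]; apply/val_inj/funext => f; apply/val_inj/funext => g /=.
  by rewrite /ext_end_fun -[1%g]red1 resE /= /rtrans inc1 mul1g.
rewrite -[RHS]/(phi (res (cC g (ext_end psi f))) 1%g).
by rewrite -(gend_rep (ext_end psi) g f) res_ext_end.
Qed.

Definition ext_end_rmorphism : {rmorphism gend C -> gend cC} :=
  HB.pack ext_end (GRing.isZmodMorphism.Build _ _ ext_end ext_end_zmod)
    (GRing.isMonoidMorphism.Build _ _ ext_end ext_end_monoid).

Local Notation P := (invariants cC K1).

Fact infl_inv_subproof (c : X) : (infl c : gendmod cC) \in @inv_pred K tX Gt cC K1.
Proof.
apply/asboolP => _ /K1E [k k1 ->].
apply: (etrans (esym (infl_equiv k c))); rewrite k1; congr infl.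
exact: ind_rep1.
Qed.

Definition infl_inv (c : gendmod C) : P := Invariant (infl_inv_subproof c).

Lemma infl_invD : {morph infl_inv : c d / c + d}.
Proof.
by move=> c d; apply/val_inj; have := infl_linear 1 c d; rewrite !scale1r.
Qed.

Lemma infl_invZ phi c : infl_inv (phi *: c) = ext_end phi *: infl_inv c.
Proof. by apply/val_inj; rewrite -[RHS]/(ext_end phi (infl c)) ext_end_infl. Qed.

Definition inv_fun (p : P) : tX := inv_val p.

Lemma inv_inc (p : P) g k l : red k = red l ->
  inv_fun p (g * inc k)%g = inv_fun p (g * inc l)%g.
Proof.
move=> kl; have pK1 : cC (inc (l^-1 * k)%g) (inv_fun p) = inv_fun p.
  case: p => p /= /asboolP; apply; apply/K1E; exists (l^-1 * k)%g => //.
  by rewrite redM redV kl mulVg.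
by rewrite -[in RHS]pK1 /= /rtrans -!mulgA -incM mulVKg.
Qed.

Definition double_coset (x y : Gt) : Prop :=
  exists s k, I1 s /\ y = (s * x * inc k)%g.

Lemma double_coset_refl x : double_coset x x.
Proof. by exists 1%g, 1%g; rewrite inc1 mul1g mulg1; split=> //; exact: I1_1. Qed.

Lemma double_coset_sym x y : double_coset x y -> double_coset y x.
Proof.
move=> [s [k [I1s ->]]]; exists s^-1%g, k^-1%g; split; first exact: I1_V.
by rewrite -!mulgA mulKg incV mulgV mulg1.
Qed.

Lemma double_coset_trans x y z :
  double_coset x y -> double_coset y z -> double_coset x z.
Proof.
move=> [s [k [I1s ->]]] [t [l [I1t ->]]]; exists (t * s)%g, (k * l)%g.
by split; [exact: I1_M|rewrite incM !mulgA].
Qed.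

(** An adapted element that depends only on the double coset of x. *)
Definition dcrep (x : Gt) : Gt :=
  xget 1%g [set g | adapted g /\ double_coset x g].

Lemma dcrepP x : adapted (dcrep x) /\ double_coset x (dcrep x).
Proof.
apply: (@xgetPex _ 1%g [set g | adapted g /\ double_coset x g]).
have [s [k [I1s ga]]] := adapted_ex x.
by exists (s * x * inc k)%g; split=> //; exists s, k.
Qed.

Lemma dcrep_eq x y : double_coset x y -> dcrep x = dcrep y.
Proof.
move=> xy; congr (xget _ _); apply/seteqP; split=> g [ga xg]; split=> //.
  exact: double_coset_trans (double_coset_sym xy) xg.
exact: double_coset_trans xy xg.
Qed.

(** The double cosets of I_1 and K, each represented by an adapted
    element. *)
Definition dcindex : choiceType := {g : Gt | g == dcrep g}.

Lemma dcindex_adapted (i : dcindex) : adapted (val i).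
Proof. by rewrite (eqP (valP i)); case: (dcrepP (val i)). Qed.

Fact dcindex_subproof x : dcrep x == dcrep (dcrep x).
Proof. by apply/eqP/dcrep_eq; case: (dcrepP x). Qed.

Definition dcindex_of (x : Gt) : dcindex := exist _ (dcrep x) (dcindex_subproof x).

Lemma dcindex_of_eq (i : dcindex) x : double_coset (val i) x -> dcindex_of x = i.
Proof.
by move=> ix; apply/val_inj; rewrite /= -(dcrep_eq ix) -(eqP (valP i)).
Qed.

(** An element u of U lifts to k in K with g k g^-1 in I_1, because g is
    adapted; so left translation by u does not change the function. *)
Fact coef_subproof (i : dcindex) (p : P) :
  (fun x => inv_fun p (val i * inc (lift x))%g) \in @ind_pred K Gb U.
Proof.
apply/asboolP => u x Uu; have [_ /(_ u Uu)[k ku I1k]] := dcindex_adapted i.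
rewrite (@inv_inc _ _ _ (k * lift x)%g); last by rewrite redM !liftK ku.
by rewrite incM -[in RHS](tX_mull _ _ I1k) !mulgA mulgVK.
Qed.

Definition coef i p : gendmod C := Ind (coef_subproof i p).

Lemma coefE i p k : (coef i p : X) (red k) = inv_fun p (val i * inc k)%g.
Proof. by apply: inv_inc; rewrite liftK. Qed.

Lemma coefD i : {morph coef i : p q / p + q}.
Proof. by move=> p q; apply/val_inj. Qed.

(** The double cosets I_1 g K cover the group. *)
Lemma coef_eq0 p : (forall i, coef i p = 0) -> p = 0.
Proof.
move=> p0; apply/val_inj/val_inj/funext => y /=.
have [_ /double_coset_sym [s [k [I1s yE]]]] := dcrepP y.
have := coefE (dcindex_of y) p k; rewrite p0 /= => e.
by rewrite {1}yE -mulgA tX_mull // -[LHS]e.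
Qed.

Lemma coef_fin p : finite_set [set i | coef i p != 0].
Proof.
have [_ finp] : is_cind I1 (inv_fun p) by case: (inv_fun p) => f' /= /asboolP.
apply: (sub_finite_set _ (finite_image (fun A => dcindex_of (xget 1%g A)) finp)).
move=> i /= ci.
have [x px] : exists x, inv_fun p (val i * inc (lift x))%g != 0.
  apply/not_existsP => p0; move/eqP: ci; apply; apply/val_inj/funext => x /=.
  by have /negP/negPn/eqP := p0 x.
exists (rcos I1 (val i * inc (lift x))%g).
  by exists (val i * inc (lift x))%g.
set A := rcos I1 _; have [s I1s sE] : A (xget 1%g A).
  by apply: xgetPex; exists (val i * inc (lift x))%g; exact: rcos_refl I1_1 _.
by apply: dcindex_of_eq; exists s, (lift x); rewrite -sE mulgA.
Qed.

(** The double coset I_1 g I_1. *)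
Definition dcset (g : Gt) : set Gt :=
  [set y | exists s k, [/\ I1 s, U (red k) & y = (s * g * inc k)%g]].

Fact dcfun_subproof g : indic (dcset g) \in @cind_pred K Gt I1.
Proof.
apply/asboolP; split.
  move=> s y I1s; congr (if _ then _ else _); apply: asbool_equiv_eq.
  split=> -[t [k [I1t Uk e]]]; last first.
    by exists (s * t)%g, k; split; rewrite ?e ?mulgA //; exact: I1_M.
  exists (s^-1 * t)%g, k; split=> //; first by apply: I1_M => //; exact: I1_V.
  by rewrite -(mulKg s y) e !mulgA.
apply: (sub_finite_set _ (fin g)) => _ [y /= gy <-].
have [[s [k [I1s Uk ->]]]|ny] := pselect (dcset g y); last first.
  by rewrite indicF ?eqxx in gy.
by exists k => //; rewrite -mulgA -[LHS](rcos_mull I1_M I1_V _ I1s).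
Qed.

Definition dcfun g : tX := CInd (dcfun_subproof g).

Lemma dcfun_inv g s : I1 s -> cC s (dcfun g) = dcfun g.
Proof.
move=> [l Ul <-]; apply/val_inj/funext => y /=; rewrite /rtrans.
congr (if _ then _ else _); apply: asbool_equiv_eq.
split=> -[t [k [I1t Uk e]]].
  exists t, (k * l^-1)%g; split; rewrite ?redM ?redV //.
    by apply: UM => //; exact: UV.
  by rewrite incM incV mulgA -e mulgK.
by exists t, (k * l)%g; split; rewrite ?redM ?incM ?e ?mulgA //; exact: UM.
Qed.

Fact hecke_subproof g : frob cC (dcfun g) \in gend_pred cC.
Proof.
apply/asboolP; split.
  exact: frob_linear.
exact: (frob_equiv I1_1 I1_M I1_V (@dcfun_inv g)).
Qed.

Definition hecke g : gend cC := Gend (hecke_subproof g).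

Lemma tX_sumE (J : Type) (r : seq J) (F : J -> tX) y :
  (\sum_(j <- r) F j : tX) y = \sum_(j <- r) F j y.
Proof. by elim: r => [|j r ih]; rewrite ?big_nil // !big_cons -ih. Qed.

(** The value at i k of the left-hand function is the sum of the c(l) over
    the cosets I_1 l in K for which i k l^-1 lies in I_1 j I_1.  For
    different double cosets there is no such l; for i = j, since i is adapted,
    k l^-1 must lie in I_1, so the only term is c(k). *)
Lemma coef_hecke (i j : dcindex) c :
  coef i (hecke (val j) *: infl_inv c) = if i == j then c else 0.
Proof.
have [r [ur rQ rf]] := cind_supp (infl c).
apply/val_inj/funext => x /=; set k := lift x.
rewrite -[LHS]/((frob cC (dcfun (val j)) (infl c) : tX) (val i * inc k)%g).
rewrite (frobE cC _ ur rQ rf) tX_sumE.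
have termE y : ((infl c y : K) *: cC y^-1%g (dcfun (val j)) : tX) (val i * inc k)%g =
    infl c y * indic (dcset (val j)) (val i * inc k * y^-1)%g by [].
under eq_bigr do rewrite termE.
have [<-{j termE}|ij] := eqVneq i j; last first.
  rewrite big1 // => y _.
  have [[l -> _]|[_ y0]] := infl_funP c y; last by rewrite /= y0 mul0r.
  rewrite indicF ?mulr0 // => -[s [m [I1s _ e]]]; case/eqP: ij.
  rewrite -(@dcindex_of_eq j (val i)).
    by rewrite (@dcindex_of_eq i) //; exact: double_coset_refl.
  exists s, (m * l * k^-1)%g; split=> //.
  by rewrite !incM incV !mulgA -e mulgVK mulgK.
have [adU _] := dcindex_adapted i.
have far y : infl c y != 0 -> y \in r -> y != crep I1 (inc k) ->
    ~ dcset (val i) (val i * inc k * y^-1)%g.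
  have [[l -> _ _]|[_ y0]] := infl_funP c y; last by rewrite /= y0 eqxx.
  move=> lr; have lQ := rQ _ lr; apply: contra_neq_not.
  move=> [s [m [I1s Um e]]].
  have /adU : I1 (val i * inc (k * l^-1 * m^-1) * (val i)^-1)%g.
    rewrite !incM !incV !mulgA e; move: I1s; rewrite -!mulgA.
    by rewrite (mulgA (inc m)) mulgV mul1g mulgV mulg1.
  rewrite !redM !redV => Ukl.
  have : U (red k * (red l)^-1)%g by rewrite -[X in U X](mulgVK (red m)); exact: UM.
  move=> {}Ukl; rewrite -lQ -[k](mulgVK l) incM [RHS](crep_mull I1_M I1_V) //.
  by apply/I1_inc; rewrite redM redV.
have crepE : infl c (crep I1 (inc k)) = c x.
  by rewrite (cind_crep I1_1) inflE liftK.
have [c0|c0] := eqVneq (c x) 0.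
  rewrite big_seq big1 ?c0 // => y yr.
  have [y0|y0] := eqVneq (infl c y) 0; first by rewrite y0 mul0r.
  rewrite indicF ?mulr0 //; apply: far => //.
  by apply: contra_neq y0 => ->; rewrite crepE.
have inr : crep I1 (inc k) \in r.
  by apply: rf; rewrite ?(crepK I1_1 I1_M I1_V) ?crepE.
rewrite (bigD1_seq _ inr ur) big_seq_cond big1 => [|y /andP[yr yk]].
  have [s I1s ->] := crepP I1_1 (inc k).
  rewrite (tX_mull (infl c)) // inflE liftK indicT ?mulr1 //; first exact: addr0.
  case: I1s => l Ul <-; exists 1%g, (l^-1)%g; split; first exact: I1_1.
    by rewrite redV; exact: UV.
  by rewrite mul1g invgM mulgA mulgK incV.
have [y0|y0] := eqVneq (infl c y) 0; first by rewrite y0 mul0r.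
by rewrite indicF ?mulr0 //; exact: far.
Qed.

(** The difference of the two sides has all its coefficients zero. *)
Lemma coef_sum p (r : seq dcindex) : uniq r ->
  (forall i, coef i p != 0 -> i \in r) ->
  p = \sum_(i <- r) hecke (val i) *: infl_inv (coef i p).
Proof.
move=> ur rp; apply/eqP; rewrite -subr_eq0; apply/eqP/coef_eq0 => j.
have coefN q : coef j (- q) = - coef j q.
  by apply/eqP; rewrite -addr_eq0 -coefD addNr; apply/eqP/val_inj.
rewrite coefD coefN (additive_sum _ _ (coefD j)).
under eq_bigr do rewrite coef_hecke.
have [jr|/negP jr] := boolP (j \in r).
  rewrite (bigD1_seq _ jr ur) /= eqxx big1 ?addr0 ?subrr // => i ij.
  by rewrite eq_sym (negbTE ij).
have -> : coef j p = 0 by have [//|/rp] := eqVneq (coef j p) 0.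
rewrite big_seq big1 ?subr0 // => i ir; case: eqP => // ji.
by rewrite ji ir in jr.
Qed.

Lemma infl_indicU w : infl indicU w = indic I1 w.
Proof.
rewrite -[LHS]/(infl_fun indicU w).
have [[k -> ->]|[nw ->]] := infl_funP indicU w; last first.
  by rewrite indicF // => -[k _ /nw].
by congr (if _ then _ else _); apply: asbool_equiv_eq; rewrite I1_inc.
Qed.

Lemma frob_indicU (f : tX) : frob cC (infl indicU) f = f.
Proof.
have [r [ur rQ rf]] := cind_supp f.
rewrite (frobE cC _ ur rQ rf); apply/val_inj/funext => z.
rewrite -[LHS]/((\sum_(x <- r) (f x : K) *: cC x^-1%g (infl indicU) : tX) z).
rewrite -[RHS]/(f z) tX_sumE.
have termE y : ((f y : K) *: cC y^-1%g (infl indicU) : tX) z =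
    f y * indic I1 (z * y^-1)%g.
  by rewrite -infl_indicU.
under eq_bigr do rewrite termE.
have near y : I1 (z * y^-1)%g -> f y = f z /\ crep I1 y = crep I1 z.
  by move=> zy; rewrite -[z](mulgVK y) tX_mull // (crep_mull I1_M I1_V).
have [z0|z0] := eqVneq (f z) 0.
  rewrite z0 big1 // => y _.
  have [/near[-> _]|zy] := pselect (I1 (z * y^-1)%g); first by rewrite z0 mul0r.
  by rewrite indicF ?mulr0.
have zr : crep I1 z \in r.
  by apply: rf; rewrite ?(crepK I1_1 I1_M I1_V) ?(cind_crep I1_1).
rewrite (bigD1_seq _ zr ur) big_seq_cond big1 => [|y /andP[yr yz]].
  rewrite (cind_crep I1_1) indicT ?mulr1; first exact: addr0.
  have [s I1s ->] := crepP I1_1 z.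
  by rewrite invgM mulgA mulgV mul1g; exact: I1_V.
rewrite indicF ?mulr0 // => /near[_ yz']; case/eqP: yz.
by rewrite -(rQ _ yr).
Qed.

(** Every function in calC is a combination of translates of the indicator
    function of I_1. *)
Lemma indicU_generates (x y : gend cC) : x (infl indicU) = y (infl indicU) -> x = y.
Proof.
move=> xy; apply/val_inj/funext => f; rewrite -[f]frob_indicU.
have [r [ur rQ rf]] := cind_supp f.
rewrite (frobE cC _ ur rQ rf) -[LHS]/(x _) -[RHS]/(y _) !linear_sum.
by apply: eq_bigr => z _; rewrite !linearZ /= !gend_rep xy.
Qed.

(** The maps [infl], x and [coef i] are K-equivariant, so their composite is
    an endomorphism of C; it is the coordinate of x along [hecke i] in
    calH. *)
Definition hecke_coef_fun i (x : gend cC) (c : X) : X := coef i (x *: infl_inv c).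

Fact hecke_coef_subproof i x : hecke_coef_fun i x \in gend_pred C.
Proof.
apply/asboolP; split=> [a c d|g c]; apply/val_inj/funext => y.
  rewrite -[LHS]/((x (infl (a *: c + d)) : tX) _) infl_linear linearP.
  by [].
rewrite -[LHS]/((x (infl (C g c)) : tX) _) -{1}(liftK g) infl_equiv gend_rep.
rewrite /= /rtrans -mulgA -incM.
apply: (@inv_inc (x *: infl_inv c)); by rewrite redM !liftK.
Qed.

Definition hecke_coef i x : gend C := Gend (hecke_coef_subproof i x).

(** By [coef_sum] both sides agree on the indicator function of I_1, which
    generates calC. *)
Lemma hecke_coef_sum x (r : seq dcindex) : uniq r ->
  (forall i, coef i (x *: infl_inv indicU) != 0 -> i \in r) ->
  x = \sum_(i <- r) hecke (val i) * ext_end (hecke_coef i x).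
Proof.
move=> ur rx; apply: indicU_generates.
rewrite (additive_sum (f := fun z : gend cC => z (infl indicU))) //.
have := congr1 inv_fun (coef_sum ur rx).
rewrite -[LHS]/(x (infl indicU)) => ->; rewrite (additive_sum (f := inv_fun)) //.
apply: eq_bigr => i _.
by rewrite -[RHS]/(hecke (val i) (ext_end (hecke_coef i x) (infl indicU))) ext_end_infl.
Qed.

Lemma hecke_coef_out x (r : seq dcindex) : uniq r ->
  (forall i, coef i (x *: infl_inv indicU) != 0 -> i \in r) ->
  forall i, i \notin r -> hecke_coef i x = 0.
Proof.
move=> ur rx j jr; apply/val_inj/funext => c.
rewrite -[LHS]/(coef j (x *: infl_inv c)) {1}(hecke_coef_sum ur rx).
rewrite scaler_suml (additive_sum _ _ (coefD j)) big_seq big1 // => i ir.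
rewrite -scalerA -infl_invZ coef_hecke; case: eqP => // ji.
by rewrite ji ir in jr.
Qed.

Lemma hecke_coef_supp x : exists r : seq dcindex, [/\ uniq r,
  forall i, i \notin r -> hecke_coef i x = 0 &
  x = \sum_(i <- r) hecke (val i) * ext_end (hecke_coef i x)].
Proof.
have [r ur rE] := finite_set_seq (coef_fin (x *: infl_inv indicU)).
by exists r; split=> //; [exact: hecke_coef_out|exact: hecke_coef_sum].
Qed.

(** The part of x supported on K, as an element of H. *)
Definition cut_end_fun (x : gend cC) (c : X) : X := res (x (infl c)).

Fact cut_end_subproof x : cut_end_fun x \in gend_pred C.
Proof.
apply/asboolP; rewrite /cut_end_fun; split=> [a c d|g c].
  by rewrite infl_linear linearP res_linear.
by rewrite -[in LHS](liftK g) infl_equiv gend_rep res_equiv liftK.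
Qed.

Definition cut_end x : gend C := Gend (cut_end_subproof x).

Theorem flat_invariants : flat (gend cC) P <-> flat (gend C) (gendmod C).
Proof.
apply: (@flat_descent _ _ ext_end_rmorphism _ _ infl_inv infl_invD infl_invZ
  dcindex (fun i => hecke (val i)) coef hecke_coef coefD coef_fin _ _ _ _
  cut_end).
- move=> x; have [r [_ r0 _]] := hecke_coef_supp x.
  apply: (sub_finite_set _ (finite_seq r)) => i /= xi.
  by apply: contraNT xi => /r0 ->.
- move=> p; have [r ur rE] := finite_set_seq (coef_fin p).
  rewrite (fsumE (r := r)) // => [|i /negP ir].
    exact: coef_sum.
  have -> : coef i p = 0 by have [//|/rE] := eqVneq (coef i p) 0.
  by rewrite (additive0 infl_invD) scaler0.
- move=> x; have [r [ur r0 xE]] := hecke_coef_supp x.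
  rewrite (fsumE (r := r)) // => i /r0 ->.
  by rewrite rmorph0 mulr0.
- by [].
- by move=> x y; apply/val_inj/funext => c; apply: val_inj.
- by apply/val_inj/funext => c; exact: res_infl.
- by move=> phi x; apply/val_inj/funext => c; exact: res_ext_end.
- move=> x phi; apply/val_inj/funext => c.
  by rewrite -[LHS]/(res (x (ext_end phi (infl c)))) ext_end_infl.
Qed.

End Parahoric.

(** * Ultrametric estimates and finite nets *)

Section Valuation.
Variables (R : realType) (F : localFieldType R).

Lemma absFD_le (x y : F) b : absF x <= b -> absF y <= b -> absF (x + y) <= b.
Proof. by move=> xb yb; rewrite (le_trans (absFD _ _)) // ge_max xb. Qed.

Lemma absFD_lt (x y : F) b : absF x < b -> absF y < b -> absF (x + y) < b.
Proof. by move=> xb yb; rewrite (le_lt_trans (absFD _ _)) // gt_max xb. Qed.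

Lemma absFB_le (x y : F) b : absF x <= b -> absF y <= b -> absF (x - y) <= b.
Proof. by move=> xb yb; apply: absFD_le; rewrite ?absFN. Qed.

Lemma absFB_lt (x y : F) b : absF x < b -> absF y < b -> absF (x - y) < b.
Proof. by move=> xb yb; apply: absFD_lt; rewrite ?absFN. Qed.

Lemma absF_gt0 (x : F) : (0 < absF x) = (x != 0).
Proof.
rewrite lt_def absF_ge0 andbT; apply/idP/idP; last exact: absF_neq0.
by apply: contra_neq => ->; rewrite absF0.
Qed.

Lemma absF_sum_lt (I : finType) (f : I -> F) b : 0 < b ->
  (forall i, absF (f i) < b) -> absF (\sum_i f i) < b.
Proof.
move=> b0 fb; elim/big_ind: _ => [|x y|i _]; first by rewrite absF0.
  exact: absFD_lt.
exact: fb.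
Qed.

Lemma absFX (x : F) m : absF (x ^+ m) = absF x ^+ m.
Proof. by elim: m => [|m ih]; rewrite ?expr0 ?absF1 // !exprS absFM ih. Qed.

Lemma small_absF (d : R) : 0 < d -> exists2 t : F, t != 0 & absF t < d.
Proof.
move=> d0.
have [x x0 x1] : exists2 x : F, x != 0 & absF x < 1.
  have [x x0] := @absF_nontrivial R F.
  rewrite neq_lt => /orP[x1|x1]; first by exists x.
  exists x^-1; first by rewrite invr_eq0.
  by rewrite absFV invf_lt1 // absF_gt0.
have xcvg : (absF x ^+ m @[m --> \oo] --> 0)%classic.
  by apply: cvg_expr; rewrite ger0_norm // absF_ge0.
have /cvgrPdist_lt/(_ _ d0)[m _ /(_ m (leqnn m))] := xcvg.
rewrite sub0r normrN ger0_norm ?exprn_ge0 ?absF_ge0 // => xm.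
by exists (x ^+ m); rewrite ?expf_neq0 // absFX.
Qed.

(** A compact neighbourhood of 0 contains t O for some nonzero t.  A finite
    cover of it by balls of radius e |t|, divided by t, gives the net. *)
Lemma finite_net (e : R) : 0 < e -> exists s : seq F,
  forall x : F, absF x <= 1 -> exists2 y, y \in s & absF (x - y) < e.
Proof.
move=> e0.
have [V V0 [cptV _]] := @locally_compactF R F 0 I.
have {V0} : nbhs (0 : F) V.
  by move: V0; rewrite withinET.
move=> /absF_nbhs[d d0 dV].
have [t t0 td] := small_absF d0.
have e't0 : 0 < e * absF t by rewrite mulr_gt0 // absF_gt0.
pose Fs : set_system (seq F) := [set P | exists s0 : seq F, forall s,
  {subset s0 <= s} -> P s].
have FFs : Filter Fs.
  split=> [|P Q [s0 Ps] [s1 Qs]|P Q PQ [s0 Ps]]; first by exists [::].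
    exists (s0 ++ s1) => s ss; split; [apply: Ps|apply: Qs] => x xs;
      by apply: ss; rewrite mem_cat xs ?orbT.
  by exists s0 => s ss; apply/PQ/Ps.
have /compact_near_coveringP/(_ _ Fs (fun s x =>
  exists2 y : F, y \in s & absF (x - y) < e * absF t) FFs) covV := cptV.
have [s0 /(_ s0 (fun _ => id)) Vs] : Fs (fun s => V `<=`
    [set x | exists2 y : F, y \in s & absF (x - y) < e * absF t]).
  apply: covV => x Vx.
  exists ([set y : F | absF (x - y) < e * absF t], [set s : seq F | x \in s]).
    split; last by exists [:: x] => s; apply; rewrite inE.
    by apply/absF_nbhs; exists (e * absF t).
  move=> [x' s] /= [xx' xs]; exists x => //.
  by rewrite -absFN opprB.
exists [seq y / t | y <- s0] => x x1.
have [|y ys xy] := Vs (x * t).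
  apply/dV; rewrite /= sub0r absFN absFM (le_lt_trans _ td) //.
  by rewrite ler_piMl // absF_ge0.
exists (y / t); first exact: map_f.
rewrite -(@ltr_pM2r _ (absF t)) ?absF_gt0 // -absFM.
by rewrite mulrBl divfK.
Qed.

Local Notation O := (valring F).
Local Notation incl := (valring_incl F).

Lemma valring_unitE (x : O) : (x \is a GRing.unit) = (residue F x != 0).
Proof.
rewrite residue_eq0 -[LHS]/(absF (incl x) == 1) -[X in ~~ X]/(absF (incl x) < 1).
by rewrite -leNgt eq_le valringP.
Qed.

Lemma residue_unitmx n (X : 'M[O]_n) :
  (map_mx (residue F) X \in unitmx) = (X \in unitmx).
Proof. by rewrite !unitmxE det_map_mx valring_unitE unitfE. Qed.

Lemma residue_lt1 (x y : O) : (residue F x == residue F y) = (absF (incl x - incl y) < 1).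
Proof. by rewrite -subr_eq0 -rmorphB residue_eq0 -rmorphB. Qed.

Lemma residue_repr (u : resfield F) : residue F (repr u) = u.
Proof. exact: reprK. Qed.

Lemma valring_mx n (X : 'M[F]_n) : (forall i j, absF (X i j) <= 1) ->
  exists Y : 'M[O]_n, map_mx incl Y = X.
Proof.
move=> X1; exists (\matrix_(i, j) ValRing (X1 i j : X i j \in @valring_pred R F)).
by apply/matrixP => i j; rewrite !mxE.
Qed.

End Valuation.

(** * The pro-p Iwahori subgroup in coordinates *)

Lemma GL_mapM n (A B : comUnitRingType) (f : {rmorphism A -> B}) :
  {morph @GL_map n A B f : x y / (x * y)%g}.
Proof. by move=> x y; apply/val_inj; rewrite /= map_mxM. Qed.

Lemma GL_mapV n (A B : comUnitRingType) (f : {rmorphism A -> B}) (x : GL n A) :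
  GL_map f x^-1%g = (GL_map f x)^-1%g.
Proof.
have map1 : GL_map f 1%g = 1%g :> GL n B by apply/val_inj; rewrite /= map_mx1.
by apply: (mulgI (GL_map f x)); rewrite -GL_mapM !mulgV map1.
Qed.

Lemma unitriangular_unitmx n (k : fieldType) (M : 'M[k]_n) :
  (forall i j : 'I_n, (j <= i)%N -> M i j = (i == j)%:R) -> M \in unitmx.
Proof.
move=> Mu; rewrite unitmxE -det_tr det_trig.
  by rewrite big1 ?unitr1 // => i _; rewrite mxE Mu ?eqxx.
apply/is_trig_mxP => i j ij; rewrite mxE Mu ?(ltnW ij) //.
by case: eqP => // ji; rewrite ji ltnn in ij.
Qed.

Section Unipotent.
Variables (n : nat) (k : fieldType).
Local Notation U := (unipotent_upper n k).

Lemma unipotent_upper1 : U 1%g.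
Proof. by move=> i j ji /=; rewrite mxE. Qed.

Lemma unipotent_upperM x y : U x -> U y -> U (x * y)%g.
Proof.
move=> Ux Uy i j ji /=; rewrite mxE.
have [->{i ji}|ij] := eqVneq i j.
  rewrite (bigD1 j) //= Ux // Uy // eqxx mulr1 big1 ?addr0 // => l lj.
  have [lj'|jl] := leqP l j; first by rewrite Ux // eq_sym (negbTE lj) mul0r.
  by rewrite Uy ?(ltnW jl) // (negbTE lj) mulr0.
rewrite big1 // => l _.
have [li|il] := leqP l i.
  rewrite Ux //; case: eqP => [il|_]; last by rewrite mul0r.
  by rewrite -il Uy // (negbTE ij) mulr0.
rewrite Uy ?(leq_trans ji (ltnW il)) //.
case: eqP => [lj|_]; last by rewrite mulr0.
by rewrite lj ltnNge ji in il.
Qed.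

Lemma unipotent_upperV x : U x -> U x^-1%g.
Proof.
(* x^-1 x = 1 determines the columns of x^-1 from left to right *)
move=> Ux i j; have [m] := ubnP j; elim: m i j => // m ih i j jm ji.
have : ((x^-1 * x)%g : 'M[k]_n) i j = (i == j)%:R by rewrite mulVg /= mxE.
rewrite /= mxE (bigD1 j) //= Ux // eqxx mulr1 big1 ?addr0 // => l lj.
have [jl|lj'] := leqP j l; first by rewrite Ux // (negbTE lj) mulr0.
rewrite -[X in X * _]/(((x^-1)%g : 'M[k]_n) i l) ih; first last.
- exact: leq_trans (ltnW lj') ji.
- exact: leq_trans lj' _.
case: eqP => [il|_]; last by rewrite mul0r.
by rewrite -il ltnNge ji in lj'.
Qed.
End Unipotent.

Section Iwahori.
Variables (n : nat) (R : realType) (F : localFieldType R).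

Local Notation O := (valring F).
Local Notation k := (resfield F).
Local Notation incl := (valring_incl F).
Local Notation inc := (@GL_map n _ _ incl).
Local Notation red := (@GL_map n _ _ (residue F)).
Local Notation U := (unipotent_upper n k).
Local Notation I1 := (proIwahori n F).

Lemma GL_incl_inj : injective inc.
Proof.
move=> x y /(congr1 (@GL_mx _ _)) /= /matrixP xy; apply/val_inj/matrixP => i j.
by have := xy i j; rewrite !mxE => /val_inj.
Qed.

Lemma GL_residue_lift (x : GL n k) (Y : 'M[O]_n) :
  map_mx (residue F) Y = x -> exists2 y, red y = x & (y : 'M[O]_n) = Y.
Proof.
move=> Yx.
have Yu : Y \in unitmx by have := Defs.GL_unit x; rewrite -Yx residue_unitmx.
by exists (MkGL Yu) => //; apply/val_inj.
Qed.

Lemma GL_residue_surj (x : GL n k) : exists y, red y = x.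
Proof.
have [|y yx _] := @GL_residue_lift x (map_mx (fun u : k => repr u : O) x).
  by apply/matrixP => i j; rewrite !mxE residue_repr.
by exists y.
Qed.

Lemma incl_le1 (x : O) : absF (incl x) <= 1.
Proof. exact: valringP. Qed.

(** Integral entries with unitriangular reduction suffice: the determinant
    then has reduction 1, so it is a unit of O. *)
Lemma proIwahoriP (x : GL n F) : I1 x <->
  (forall i j, absF (x i j) <= 1) /\
  (forall i j : 'I_n, (j <= i)%N -> absF (x i j - (i == j)%:R) < 1).
Proof.
split=> [[y /= Uy <-]|[x1 xU]].
  split=> [i j|i j ji] /=; rewrite mxE; first exact: incl_le1.
  have := Uy i j ji; rewrite /= mxE -(rmorph_nat (residue F)) => /eqP.
  by rewrite residue_lt1 rmorph_nat.
have [Y Yx] := valring_mx x1.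
have YU (i j : 'I_n) : (j <= i)%N -> map_mx (residue F) Y i j = (i == j)%:R.
  move=> ji; rewrite mxE -(rmorph_nat (residue F)); apply/eqP.
  have := xU i j ji; rewrite -Yx mxE => ?.
  by rewrite residue_lt1 rmorph_nat.
have Yu : Y \in unitmx.
  by rewrite -residue_unitmx; exact: unitriangular_unitmx.
exists (MkGL Yu); last exact/val_inj.
by move=> i j ji; exact: YU.
Qed.

Lemma congruence1P (x : GL n F) :
  congruence1 n F x <-> exists2 y, red y = 1%g & x = inc y.
Proof.
split=> [[X Xp xX]|[y y1 ->]].
  have [|y y1 yX] := @GL_residue_lift 1%g (1%:M + X).
    apply/matrixP => i j; rewrite !mxE rmorphD rmorph_nat /=.
    have /eqP -> : residue F (X i j) == 0 by rewrite residue_eq0.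
    by rewrite addr0.
  exists y => //; apply/val_inj; rewrite /= xX yX.
  by rewrite map_mxD map_mx1.
exists ((y : 'M[O]_n) - 1%:M) => [i j|].
  rewrite -residue_eq0 !mxE rmorphB rmorph_nat subr_eq0.
  have /matrixP/(_ i j) := congr1 (@GL_mx _ _) y1.
  by rewrite !mxE => ->.
by rewrite -(map_mx1 incl) -map_mxD addrC subrK.
Qed.

Lemma proIwahori1 : I1 1%g.
Proof.
apply/proIwahoriP; split=> [i j|i j _] /=; rewrite mxE.
  by case: eqP; rewrite ?absF1 ?absF0.
by rewrite subrr absF0.
Qed.

Lemma proIwahoriM x y : I1 x -> I1 y -> I1 (x * y)%g.
Proof.
move=> [a /= Ua <-] [b /= Ub <-]; exists (a * b)%g; last exact: GL_mapM.
by rewrite /= GL_mapM; exact: unipotent_upperM.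
Qed.

Lemma proIwahoriV x : I1 x -> I1 x^-1%g.
Proof.
move=> [a /= Ua <-]; exists a^-1%g; last exact: GL_mapV.
by rewrite /= GL_mapV; exact: unipotent_upperV.
Qed.

Lemma mulmx_absF_ltl m p q (X : 'M[F]_(m, p)) (Y : 'M[F]_(p, q)) a b :
  0 < a -> 0 < b -> (forall i j, absF (X i j) < a) ->
  (forall i j, absF (Y i j) <= b) -> forall i j, absF ((X *m Y) i j) < a * b.
Proof.
move=> a0 b0 Xa Yb i j; rewrite mxE.
apply: absF_sum_lt => [|l]; first exact: mulr_gt0.
rewrite absFM; apply: le_lt_trans (_ : absF (X i l) * b < _).
  by rewrite ler_wpM2l ?absF_ge0.
by rewrite ltr_pM2r.
Qed.

Lemma mulmx_absF_ltr m p q (X : 'M[F]_(m, p)) (Y : 'M[F]_(p, q)) a b :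
  0 < a -> 0 < b -> (forall i j, absF (X i j) <= a) ->
  (forall i j, absF (Y i j) < b) -> forall i j, absF ((X *m Y) i j) < a * b.
Proof.
move=> a0 b0 Xa Yb i j; rewrite mxE.
apply: absF_sum_lt => [|l]; first exact: mulr_gt0.
rewrite absFM; apply: le_lt_trans (_ : a * absF (Y l j) < _).
  by rewrite ler_wpM2r ?absF_ge0.
by rewrite ltr_pM2l.
Qed.

Lemma mx_absF_bound (X : 'M[F]_n) :
  exists2 b, 0 < b & forall i j, absF (X i j) <= b.
Proof.
exists (1 + \sum_(l : 'I_n * 'I_n) absF (X l.1 l.2)).
  by rewrite ltr_wpDr // sumr_ge0 // => l _; exact: absF_ge0.
move=> i j; rewrite (bigD1 (i, j)) //= addrCA lerDl addr_ge0 //.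
by rewrite sumr_ge0 // => l _; exact: absF_ge0.
Qed.

(** If l and l' are entrywise close, g l' l^-1 g^-1 is so close to 1 that it
    lies in I_1.  Thus the coset of g l depends only on approximations of the
    entries of l by points of a finite net. *)
Lemma rcos_proIwahori_fin (g : GL n F) :
  finite_set [set rcos I1 (g * inc l)%g | l in [set: GL n O]].
Proof.
have [b b0 gb] := mx_absF_bound g.
have [c c0 gc] := mx_absF_bound (g^-1)%g.
(* an error below e, multiplied by g and g^-1, ends up below 1 *)
pose e := b^-1 * c^-1.
have e0 : 0 < e by rewrite mulr_gt0 ?invr_gt0.
have [s sP] := finite_net F e0.
pose close (f : {ffun 'I_n * 'I_n -> seq_sub s}) (l : GL n O) :=
  forall i j, absF (incl (l i j) - val (f (i, j))) < e.
have closeP l : exists f, close f l.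
  have /choice[f fP] (ij : 'I_n * 'I_n) :
      exists y : seq_sub s, absF (incl (l ij.1 ij.2) - val y) < e.
    by have [y ys yl] := sP _ (incl_le1 (l ij.1 ij.2)); exists (SeqSub ys).
  by exists [ffun ij => f ij] => i j; rewrite ffunE; exact: (fP (i, j)).
pose pick f : GL n O := xget 1%g [set l | close f l].
have finT : finite_set [set: {ffun 'I_n * 'I_n -> seq_sub s}] := finite_finset.
apply: (sub_finite_set _ (finite_image (fun f => rcos I1 (g * inc (pick f))%g) finT)).
move=> _ [l _ <-]; have [f fl] := closeP l; exists f => //.
have fl' : close f (pick f) by apply: (@xgetPex _ 1%g [set l | close f l]); exists l.
move: (pick f) fl' => l' fl'.
pose y : GL n F := (g * inc l' * (g * inc l)^-1)%g.
suff I1y : I1 y.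
  have -> : (g * inc l')%g = (y * (g * inc l))%g by rewrite mulgVK.
  exact: (rcos_mull (@proIwahoriM) proIwahoriV).
pose d : 'M[F]_n := (inc l' : 'M[F]_n) - (inc l : 'M[F]_n).
have de i j : absF (d i j) < e.
  rewrite (_ : d i j =
      (incl (l' i j) - val (f (i, j))) - (incl (l i j) - val (f (i, j)))).
    exact: absFB_lt.
  by rewrite !mxE opprB addrA subrK.
have yE : (y : 'M[F]_n) = 1%:M + g *m d *m inc l^-1%g *m (g^-1)%g.
  have -> : (y : 'M[F]_n) = g *m inc l' *m inc l^-1%g *m (g^-1)%g.
    by rewrite /y invgM mulgA GL_mapV.
  have l'E : (inc l' : 'M[F]_n) = (inc l : 'M[F]_n) + d by rewrite addrC subrK.
  rewrite l'E mulmxDr !mulmxDl; congr (_ + _).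
  rewrite -[LHS]/(((g * inc l * inc l^-1 * g^-1)%g : GL n F) : 'M[F]_n).
  by rewrite GL_mapV mulgK mulgV.
have y1 i j : absF (y i j - (i == j)%:R) < 1.
  rewrite yE mxE [X in X + _ - _]mxE addrC addrA addNr add0r.
  rewrite (_ : 1 = b * e * 1 * c); last first.
    by rewrite mulr1 /e mulrA mulfV ?gt_eqF // mul1r mulVf // gt_eqF.
  have be0 : 0 < b * e by rewrite mulr_gt0.
  apply: mulmx_absF_ltl; rewrite ?mulr1 // => {}i {}j.
  rewrite -[X in _ < X]mulr1; apply: mulmx_absF_ltl => // {}i {}j.
    exact: mulmx_absF_ltr.
  by rewrite /= mxE; exact: incl_le1.
apply/proIwahoriP; split=> // i j.
rewrite -(subrK (i == j)%:R (y i j)); apply: absFD_le; first exact: ltW.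
by case: eqP; rewrite ?absF1 ?absF0.
Qed.

End Iwahori.

(** * Gaussian elimination with pivots of maximal absolute value *)

Lemma sqr0_unitmx n (A : comUnitRingType) (N : 'M[A]_n) :
  N *m N = 0 -> 1%:M - N \in unitmx.
Proof.
move=> N2; have /mulmx1_unit[] // : (1%:M - N) *m (1%:M + N) = 1%:M.
by rewrite mulmxDr mulmx1 mulmxBl mul1mx N2 subr0 subrK.
Qed.

Section Elimination.
Variables (n : nat) (R : realType) (F : localFieldType R).

Local Notation O := (valring F).
Local Notation k := (resfield F).
Local Notation incl := (valring_incl F).
Local Notation inc := (@GL_map n _ _ incl).
Local Notation red := (@GL_map n _ _ (residue F)).
Local Notation U := (unipotent_upper n k).
Local Notation I1 := (proIwahori n F).

(** The state of the elimination once the columns from m on are done: column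
    j keeps only its pivot, in row p j, and that row keeps only this pivot.
    The last clause records how pivots are chosen: the pivot of column j
    bounds all columns on its left, strictly in the rows below its own. *)
Definition cleared (m : nat) (p : 'I_n -> 'I_n) (Y : 'M[F]_n) : Prop :=
  [/\ forall j : 'I_n, (m <= j)%N -> Y (p j) j != 0,
      forall i j : 'I_n, (m <= j)%N -> i != p j -> Y i j = 0,
      forall j l : 'I_n, (m <= j)%N -> l != j -> Y (p j) l = 0 &
      forall j i a : 'I_n, (m <= j)%N -> (i < j)%N ->
        absF (Y a i) <= absF (Y (p j) j) /\
        ((p j < a)%N -> absF (Y a i) < absF (Y (p j) j))].

(** Let t_j be the entry of g in position (p j, j).  Conjugation by g moves the
    entry (i, j) to (p i, p j) and multiplies it by t_i / t_j.  For i < j the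
    last clause of [cleared] gives |t_i| <= |t_j|, strictly if p j < p i; this
    is just what is needed for the conjugate of I_1 to meet K in matrices that
    reduce into U, and for the unitriangular integral matrices to be conjugated
    into I_1. *)
Lemma cleared_adapted (g : GL n F) p : cleared 0 p g -> adapted inc red U g.
Proof.
move=> [g0 gcol grow gle].
have key (y : GL n F) (l : GL n O) : (y * g)%g = (g * inc l)%g ->
    forall i j, y (p i) (p j) * g (p j) j = g (p i) i * incl (l i j).
  move=> /(congr1 (@GL_mx _ _)) /= /matrixP yg i j; have := yg (p i) j.
  rewrite !mxE (bigD1 (p j)) //= big1 ?addr0 => [->|q qj]; last first.
    by rewrite gcol ?mulr0.
  rewrite (bigD1 i) //= big1 ?addr0 ?mxE // => q qi.
  by rewrite grow ?mul0r.
have pinj : injective p.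
  move=> i j ij; apply/eqP; apply: contraT => nij.
  by have := g0 i (leq0n _); rewrite ij grow // eqxx.
have gpos j : 0 < absF (g (p j) j) by rewrite absF_gt0 g0.
split=> [l /proIwahoriP [y1 yU] i j ji|u Uu].
  set y := (g * inc l * g^-1)%g in y1 yU.
  have {key}key := key y l (mulgVK _ _).
  rewrite /= mxE -(rmorph_nat (residue F)); apply/eqP.
  rewrite residue_lt1 rmorph_nat.
  have -> : incl (l i j) = y (p i) (p j) * g (p j) j / g (p i) i.
    by rewrite key mulrAC mulfV ?mul1r // g0.
  have [->|nij] := eqVneq i j.
    by rewrite mulfK ?g0 //; have := yU (p j) (p j) (leqnn _); rewrite eqxx.
  have {ji}ji : (j < i)%N by rewrite ltn_neqAle eq_sym nij.
  rewrite subr0 absFM absFV ltr_pdivrMr ?gpos // mul1r absFM.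
  have [gji gji'] := gle i j (p j) (leq0n _) ji.
  have [pij|pji] := leqP (p j) (p i).
    have := yU _ _ pij; rewrite (inj_eq pinj) (negbTE nij) subr0 => y1'.
    apply: le_lt_trans (_ : absF (y (p i) (p j)) * absF (g (p i) i) < _).
      by rewrite ler_wpM2l ?absF_ge0.
    by rewrite gtr_pMl.
  apply: le_lt_trans (_ : 1 * absF (g (p j) j) < _).
    by rewrite ler_wpM2r ?absF_ge0.
  by rewrite mul1r gji'.
pose Y : 'M[O]_n := \matrix_(i, j) if (j <= i)%N then (i == j)%:R else repr (u i j).
have [|l lu lY] := @GL_residue_lift n R F u Y.
  apply/matrixP => i j; rewrite !mxE; case: ifP => ji.
    by rewrite rmorph_nat Uu.
  exact: residue_repr.
exists l => //; set y := (g * inc l * g^-1)%g.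
have {}key := key y l (mulgVK _ _).
have yE i j : y (p i) (p j) = g (p i) i * incl (l i j) / g (p j) j.
  by rewrite -key mulfK ?g0.
have le1 (i j : 'I_n) : (j <= i)%N -> y (p i) (p j) = (i == j)%:R.
  move=> ji; rewrite yE lY mxE ji rmorph_nat.
  by case: eqP => [->|_]; rewrite ?mulr1 ?mulfV ?g0 // mulr0 mul0r.
have [q pq qp] := injF_bij pinj.
apply/proIwahoriP; split=> i j; rewrite -[i]qp -[j]qp.
  move: (q i) (q j) => {}i {}j.
  have [/le1 ->|ij] := leqP j i; first by case: eqP; rewrite ?absF1 ?absF0.
  rewrite yE absFM absFV ler_pdivrMr ?gpos // mul1r absFM.
  have [gij _] := gle j i (p i) (leq0n _) ij.
  by apply: le_trans gij; rewrite ler_piMr ?absF_ge0 ?incl_le1.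
move: (q i) (q j) => {}i {}j pij.
have [ji|ij] := leqP j i.
  by rewrite le1 // (inj_eq pinj) subrr absF0.
have nij : i != j by rewrite -(inj_eq val_inj) /= neq_ltn ij.
rewrite (inj_eq pinj) (negbTE nij) subr0.
rewrite yE absFM absFV ltr_pdivrMr ?gpos // mul1r absFM.
have pij' : (p j < p i)%N.
  by rewrite ltn_neqAle pij andbT (inj_eq val_inj) (inj_eq pinj) eq_sym.
have [_ /(_ pij') gij] := gle j i (p i) (leq0n _) ij.
by apply: le_lt_trans gij; rewrite ler_piMr ?absF_ge0 ?incl_le1.
Qed.

Definition is_pivot (m : 'I_n) (Y : 'M[F]_n) (r c : 'I_n) : Prop :=
  [/\ (c <= m)%N, Y r c != 0 & forall a i : 'I_n, (i <= m)%N ->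
      absF (Y a i) <= absF (Y r c) /\
      ((r < a)%N -> absF (Y a i) < absF (Y r c))].

(** Among the entries of largest absolute value in the columns up to m, take
    one in the lowest row. *)
Lemma is_pivot_ex m (Y : 'M[F]_n) : Y \in unitmx -> exists r c, is_pivot m Y r c.
Proof.
move=> Yu.
have [a0 a0m] : exists a, Y a m != 0.
  apply/existsP; apply: contraT; rewrite negb_exists => /forallP Y0.
  have : invmx Y *m Y = 1%:M by rewrite mulVmx.
  move/matrixP/(_ m m); rewrite !mxE eqxx big1 => [/esym/eqP|a _].
    by rewrite oner_eq0.
  by have /negPn/eqP -> := Y0 a; rewrite mulr0.
pose P : pred ('I_n * 'I_n) := fun l => (l.2 <= m)%N.
have [[r0 c0] /= c0m vmax] :=
  @arg_maxP _ _ _ (a0, m) P (fun l => absF (Y l.1 l.2)) (leqnn m).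
rewrite /P /= in c0m; set v := absF (Y r0 c0).
have v0 : 0 < v.
  by apply: lt_le_trans (vmax (a0, m) (leqnn m)); rewrite absF_gt0.
pose Q : pred 'I_n := fun a => [exists c : 'I_n, (c <= m)%N && (absF (Y a c) == v)].
have Qr0 : Q r0 by apply/existsP; exists c0; rewrite c0m eqxx.
have [r /existsP[c /andP[cm /eqP rc]] rmax] := @arg_maxnP _ r0 Q (fun a => a : nat) Qr0.
exists r, c; split=> //; first by rewrite -absF_gt0 rc.
move=> a i im; rewrite rc.
have av : absF (Y a i) <= v by exact: (vmax (a, i)).
split=> // ra; rewrite lt_neqAle av andbT.
apply: contraTneq ra => avE; rewrite -leqNgt.
by apply: rmax; apply/existsP; exists i; rewrite im avE eqxx.
Qed.

Lemma cleared_swap (m c : 'I_n) p Y : (c <= m)%N ->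
  cleared m.+1 p Y -> cleared m.+1 p (xcol c m Y).
Proof.
move=> cm [Y0 Ycol Yrow Yle].
have tp_gt (j : 'I_n) : (m < j)%N -> tperm c m j = j.
  move=> mj; rewrite tpermD // -(inj_eq val_inj) /= neq_ltn ?mj //.
  by rewrite (leq_ltn_trans cm mj).
have tp_lt (i j : 'I_n) : (m < j)%N -> (i < j)%N -> (tperm c m i < j)%N.
  by move=> mj ij; case: tpermP => // _; rewrite ?mj // (leq_ltn_trans cm mj).
split=> [j mj|i j mj|j l mj lj|j i a mj ij].
- by rewrite mxE tp_gt // Y0.
- by rewrite mxE tp_gt //; exact: Ycol.
- by rewrite mxE Yrow // -[X in _ != X](tp_gt j mj) (inj_eq perm_inj).
by rewrite !mxE (tp_gt j mj); exact: (Yle _ _ _ mj (tp_lt _ _ mj ij)).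
Qed.

Lemma is_pivot_swap (m c r : 'I_n) Y : is_pivot m Y r c -> is_pivot m (xcol c m Y) r m.
Proof.
move=> [cm rc rmax]; split=> //; rewrite ?mxE ?tpermR // => a i im.
by rewrite mxE; apply: rmax; case: tpermP.
Qed.

(** Right multiplication by [1 - col_clear Y r m] clears row r outside the
    pivot (r, m), after which left multiplication by [1 - row_clear Y r m]
    clears column m outside it. *)
Definition col_clear (Y : 'M[F]_n) (r m : 'I_n) : 'M[F]_n :=
  \matrix_(a, b) if a == m then (if b == m then 0 else Y r b / Y r m) else 0.
Definition row_clear (Y : 'M[F]_n) (r m : 'I_n) : 'M[F]_n :=
  \matrix_(a, b) if b == r then (if a == r then 0 else Y a m / Y r m) else 0.

Lemma col_clear_sqr0 Y r m : col_clear Y r m *m col_clear Y r m = 0.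
Proof.
apply/matrixP => a b; rewrite !mxE big1 // => l _; rewrite !mxE.
by case: (eqVneq l m) => _ /=; rewrite ?if_same ?mulr0 ?mul0r.
Qed.

Lemma row_clear_sqr0 Y r m : row_clear Y r m *m row_clear Y r m = 0.
Proof.
apply/matrixP => a b; rewrite !mxE big1 // => l _; rewrite !mxE.
by case: (eqVneq l r) => _ /=; rewrite ?if_same ?mulr0 ?mul0r.
Qed.

Lemma clearE (Y : 'M[F]_n) r m a b : Y r m != 0 ->
  ((1%:M - row_clear Y r m) *m (Y *m (1%:M - col_clear Y r m))) a b =
  if b == m then (if a == r then Y r m else 0)
  else Y a b - Y a m * (Y r b / Y r m).
Proof.
move=> rm0; set Z := Y *m _.
have ZE i j : Z i j = if j == m then Y i m else Y i j - Y i m * (Y r j / Y r m).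
  rewrite /Z mulmxBr mulmx1 mxE [X in _ + X]mxE [X in _ - X]mxE (bigD1 m) //=.
  rewrite big1 => [|l lm]; last first.
    by rewrite !mxE (negbTE lm) mulr0.
  by rewrite !mxE eqxx addr0; case: eqP => // ->; rewrite mulr0 subr0.
rewrite mulmxBl mul1mx mxE [X in _ + X]mxE [X in _ - X]mxE (bigD1 r) //=.
rewrite big1 => [|l lr]; last first.
  by rewrite !mxE (negbTE lr) mul0r.
have -> : row_clear Y r m a r = if a == r then 0 else Y a m / Y r m.
  by rewrite mxE eqxx.
rewrite addr0 !ZE.
have [_|bm] := eqVneq b m.
  by have [->|_] := eqVneq a r; rewrite ?mul0r ?subr0 // divfK // subrr.
by rewrite [Y r m * _]mulrC divfK // subrr mulr0 subr0.
Qed.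

(** All absolute values that occur are bounded by those before the step: the
    multipliers [Y r b / Y r m] are integral for b <= m by the choice of the
    pivot, and for b > m the entry [Y r b] vanishes. *)
Lemma cleared_clear (m r : 'I_n) p Y : cleared m.+1 p Y -> is_pivot m Y r m ->
  cleared m (fun j => if j == m then r else p j)
    ((1%:M - row_clear Y r m) *m (Y *m (1%:M - col_clear Y r m))).
Proof.
move=> [Y0 Ycol Yrow Yle] [_ t0 rmax].
have gtm (j : 'I_n) : (m <= j)%N -> j != m -> (m < j)%N.
  by move=> mj jm; rewrite ltn_neqAle mj andbT eq_sym.
have gt_neq (j : 'I_n) : (m < j)%N -> m != j.
  by move=> mj; rewrite -(inj_eq val_inj) /= neq_ltn mj.
have rp (j : 'I_n) : (m < j)%N -> r != p j.
  move=> mj; apply: contra_neq t0 => ->; apply: Yrow => //; exact: gt_neq.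
have Yr0 (j : 'I_n) : (m < j)%N -> Y r j = 0 by move=> mj; apply: Ycol (rp _ mj).
have Yp0 (j : 'I_n) : (m < j)%N -> Y (p j) m = 0.
  by move=> mj; apply: Yrow => //; exact: gt_neq.
have tpos : 0 < absF (Y r m) by rewrite absF_gt0.
split.
- move=> j mj; rewrite clearE //; have [_|jm] := eqVneq j m; first by rewrite eqxx.
  by rewrite Yp0 ?gtm // mul0r subr0 Y0 ?gtm.
- move=> i j mj; rewrite clearE //; have [_ /negbTE -> //|jm] := eqVneq j m.
  by move=> ip; rewrite Yr0 ?gtm // mul0r mulr0 subr0 Ycol ?gtm.
- move=> j l mj; rewrite clearE //; have [->|jm] := eqVneq j m.
    move=> /negbTE ->; by rewrite mulrC divfK // subrr.
  move=> lj; have [_|lm] := eqVneq l m.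
    by rewrite eq_sym (negbTE (rp _ (gtm _ mj jm))).
  by rewrite Yp0 ?gtm // mul0r subr0 Yrow ?gtm.
move=> j i a mj ij; rewrite !clearE //.
have quo (b : F) (l : 'I_n) : (l <= m)%N -> absF (b * (Y r l / Y r m)) <= absF b.
  move=> lm; rewrite absFM absFM absFV ler_piMr ?absF_ge0 //.
  by rewrite ler_pdivrMr // mul1r; case: (rmax r l lm).
have [jm|jm] /= := eqVneq j m.
  rewrite jm in ij; have im : i != m by rewrite -(inj_eq val_inj) /= neq_ltn ij.
  rewrite eqxx (negbTE im).
  have [ai ai'] := rmax a i (ltnW ij); have [am am'] := rmax a m (leqnn m).
  split=> [|ra].
    by apply: absFB_le => //; apply: le_trans (quo _ _ (ltnW ij)) am.
  by apply: absFB_lt; [exact: ai'|apply: le_lt_trans (quo _ _ (ltnW ij)) (am' ra)].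
have mj' := gtm _ mj jm.
rewrite Yp0 // mul0r subr0.
have [am am'] := Yle j m a mj' mj'.
have [_|im] := eqVneq i m.
  have [->|ar] := eqVneq a r; first exact: Yle.
  by rewrite absF0 absF_ge0; split=> // _; rewrite absF_gt0 Y0.
have [ai ai'] := Yle j i a mj' ij.
have [ltim|ltmi] := leqP i m.
  split=> [|pa].
    by apply: absFB_le => //; apply: le_trans (quo _ _ ltim) am.
  by apply: absFB_lt; [exact: ai'|apply: le_lt_trans (quo _ _ ltim) (am' pa)].
by rewrite Yr0 // mul0r mulr0 subr0.
Qed.

Definition reachable (x : GL n F) (Y : 'M[F]_n) : Prop :=
  exists s l, I1 s /\ (s * x * inc l)%g = Y :> 'M[F]_n.

Lemma reachable_unitmx x Y : reachable x Y -> Y \in unitmx.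
Proof. by move=> [s [l [_ <-]]]; exact: Defs.GL_unit. Qed.

Lemma reachable_mulr x Y (V : 'M[O]_n) : V \in unitmx ->
  reachable x Y -> reachable x (Y *m map_mx incl V).
Proof.
move=> Vu [s [l [I1s <-]]]; exists s, (l * MkGL Vu)%g; split=> //.
by rewrite GL_mapM mulgA.
Qed.

Lemma reachable_mull x Y (W : GL n F) : I1 W ->
  reachable x Y -> reachable x ((W : 'M[F]_n) *m Y).
Proof.
move=> I1W [s [l [I1s <-]]]; exists (W * s)%g, l; split.
  exact: proIwahoriM.
by rewrite -!mulgA.
Qed.

(** The elementary operations are allowed because of the choice of the pivot:
    its maximality makes all multipliers integral, and those that add the
    pivot row to a lower row lie in the maximal ideal, as the pivot is in the
    lowest possible row. *)
Lemma cleared_step (m : 'I_n) p x Y : reachable x Y -> cleared m.+1 p Y ->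
  exists Y' p', reachable x Y' /\ cleared m p' Y'.
Proof.
move=> xY Yp; have [r [c piv]] := is_pivot_ex m (reachable_unitmx xY).
have cm : (c <= m)%N by case: piv.
have {xY} : reachable x (xcol c m Y).
  rewrite xcolE -[tperm_mx c m](map_perm_mx incl).
  by apply: reachable_mulr xY; exact: unitmx_perm.
have {}Yp := cleared_swap cm Yp; have {}piv := is_pivot_swap piv.
move: (xcol c m Y) Yp piv => {c cm} {}Y Yp piv xY.
exists ((1%:M - row_clear Y r m) *m (Y *m (1%:M - col_clear Y r m))).
exists (fun j => if j == m then r else p j).
split; last exact: cleared_clear.
have [_ t0 rmax] := piv.
have tpos : 0 < absF (Y r m) by rewrite absF_gt0.
have Wu := sqr0_unitmx (row_clear_sqr0 Y r m).
have [|V VE] := @valring_mx R F n (col_clear Y r m).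
  move=> a b; rewrite mxE; case: ifP => _; last by rewrite absF0.
  have [_|bm] := eqVneq b m; first by rewrite absF0.
  rewrite absFM absFV ler_pdivrMr // mul1r.
  have [bm'|mb] := leqP b m; first by case: (rmax r b bm').
  rewrite (_ : Y r b = 0) ?absF0 ?ltW //.
  case: Yp => _ Ycol Yrow _; apply: Ycol => //.
  apply: contra_neq t0 => ->; apply: Yrow => //.
  by rewrite -(inj_eq val_inj) /= neq_ltn mb.
have Vu : 1%:M - V \in unitmx.
  apply: sqr0_unitmx; have := col_clear_sqr0 Y r m.
  rewrite -VE -map_mxM => /matrixP V0; apply/matrixP => a b.
  by have := V0 a b; rewrite !mxE => e; apply: val_inj.
apply: (reachable_mull (W := MkGL Wu)).
  apply/proIwahoriP; split=> /= [a b|a b ba]; rewrite !mxE.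
    apply: absFB_le; first by case: eqP; rewrite ?absF1 ?absF0.
    case: ifP => _; last by rewrite absF0.
    case: ifP => _; first by rewrite absF0.
    by rewrite absFM absFV ler_pdivrMr // mul1r; case: (rmax a m (leqnn m)).
  rewrite addrAC subrr add0r absFN.
  have [br|_] := eqVneq b r; last by rewrite absF0.
  have [_|ar] := eqVneq a r; first by rewrite absF0.
  rewrite absFM absFV ltr_pdivrMr // mul1r; case: (rmax a m (leqnn m)) => _; apply.
  by rewrite ltn_neqAle (inj_eq val_inj) eq_sym ar -br.
rewrite -VE -(map_mx1 incl) -map_mxB.
exact: reachable_mulr.
Qed.

Lemma cleared_ex x : exists Y p, reachable x Y /\ cleared 0 p Y.
Proof.
suff H m : (m <= n)%N -> exists Y p, reachable x Y /\ cleared (n - m) p Y.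
  by have := H n (leqnn n); rewrite subnn.
elim: m => [_|m ih mn].
  exists x, id; split.
    by exists 1%g, 1%g; rewrite /= map_mx1 mul1mx mulmx1; split=> //; exact: proIwahori1.
  by rewrite subn0; split=> [j|i j|j l|j i a]; rewrite leqNgt ltn_ord.
have [Y [p [xY Yp]]] := ih (ltnW mn).
have mlt : (n - m.+1 < n)%N by rewrite ltn_subrL (leq_ltn_trans _ mn).
apply: (@cleared_step (Ordinal mlt) p x Y xY).
by rewrite /= -subSn // subSS.
Qed.

Lemma adapted_ex (x : GL n F) :
  exists s l, I1 s /\ adapted inc red U (s * x * inc l)%g.
Proof.
have [Y [p [[s [l [I1s sY]]] Yp]]] := cleared_ex x.
by exists s, l; split=> //; apply: (@cleared_adapted _ p); rewrite sY.
Qed.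

End Elimination.

Theorem proposition5p15
    (R : realType) (F : localFieldType R) (p : nat)
    (hp : p \in [pchar (resfield F)])
    (Fpbar : closedFieldType) (iota : {rmorphism resfield F -> Fpbar})
    (hiota : forall x : Fpbar, algebraicOver iota x)
    (n : nat) (hn : (1 <= n)%N) :
  let cC := cind_rep Fpbar (proIwahori n F) in
  let C := ind_rep Fpbar (unipotent_upper n (resfield F)) in
  flat (gend cC) (invariants cC (congruence1 n F)) <-> flat (gend C) (gendmod C).
Proof.
move=> cC C.
exact: (@flat_invariants Fpbar _ _ _ (@GL_map n _ _ (valring_incl F))
  (@GL_map n _ _ (residue F)) (unipotent_upper n (resfield F)) (congruence1 n F)
  (@GL_mapM _ _ _ _) (@GL_incl_inj n R F) (@GL_mapM _ _ _ _) (@GL_residue_surj n R F)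
  (@unipotent_upper1 n _) (@unipotent_upperM n _) (@unipotent_upperV n _)
  (@congruence1P n R F) (@rcos_proIwahori_fin n R F) (@adapted_ex n R F)).
Qed.
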